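(* Let $j\ge \tfrac12$ be an integer or half-integer, let $\boldsymbol n_1,\boldsymbol n_2,\boldsymbol n_3$ be an orthonormal basis of $\mathbb R^3$, and let $\rho$ be a density operator on $\mathbb C^{2j+1}$ that is a minimum uncertainty state, i.e. that attains equality in the information-refined uncertainty relation $$U(\rho,J_{\boldsymbol n_1})\,U(\rho,J_{\boldsymbol n_2})\ \ge\ \tfrac14\,|\operatorname{tr}(\rho J_{\boldsymbol n_3})|^2 .$$ Then $\rho$ must be a rotation of a diagonal state or of a pure state, namely it has one of the following two forms: (i) $\rho=\sum_{n=-j}^{j}\rho_{n,n}\,R|j,n\rangle\langle j,n|R^\dagger$, where $R$ is a rotation operator and $\rho_{n,n}=s'^{\,2(j-n)}\dfrac{1-s'^2}{1-s'^{\,4j+2}}$ with $s'\in\mathbb R$; (ii) $\rho=|\varphi_m\rangle\langle\varphi_m|$ is pure, with $|\varphi_m\rangle=A_m\,R\,e^{\beta J_z}e^{-\frac{i\pi}{2}J_y}|j,m\rangle$, where $R$ is a rotation operator, $\beta\in\mathbb R$, $m\in\{-j,-j+1,\dots,j\}$ and $A_m$ is a normalization constant. More specifically, equality in the relation above holds if and only if there exist constants $s,t\in\mathbb R$ such that $$is[\sqrt\rho,J_{\boldsymbol n_1}]+\{\sqrt\rho,\,J_{\boldsymbol n_2}-\operatorname{tr}(\rho J_{\boldsymbol n_2})\}=0,\qquad it[\sqrt\rho,J_{\boldsymbol n_2}]+\{\sqrt\rho,\,J_{\boldsymbol n_1}-\operatorname{tr}(\rho J_{\boldsymbol n_1})\}=0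 ;$$ with $u=4\operatorname{tr}(\rho J_{\boldsymbol n_2})$ and $v=4\operatorname{tr}(\rho J_{\boldsymbol n_1})$, these parameters must satisfy one of the conditions (1) $s=-t$ and $u=v=0$, or (2) $st=-1$ and $u=0$; when (1) holds $\rho$ is of form (i), and when (2) holds $\rho$ is of form (ii).
   Context: Spin-$j$ system: $J_x,J_y,J_z$ are the Hermitian angular momentum operators on $\mathbb C^{2j+1}$ (irreducible representation), with $[J_x,J_y]=iJ_z$, $[J_y,J_z]=iJ_x$, $[J_z,J_x]=iJ_y$, and $J_\pm=J_x\pm iJ_y$. The Dicke states $|j,m\rangle$, $m=-j,\dots,j$, are the orthonormal basis with $J_z|j,m\rangle=m|j,m\rangle$, $J_+|j,m\rangle=\sqrt{(j-m)(j+m+1)}\,|j,m+1\rangle$, $J_-|j,m\rangle=\sqrt{(j+m)(j-m+1)}\,|j,m-1\rangle$. For a unit vector $\boldsymbol n=(n_x,n_y,n_z)$, $J_{\boldsymbol n}=n_xJ_x+n_yJ_y+n_zJ_z$. A rotation operator is $R=e^{-i\theta\,\boldsymbol w\cdot\boldsymbol J}$ with $\theta\in\mathbb R$, $\boldsymbol w\in\mathbb R^3$ a unit vector and $\boldsymbol w\cdot\boldsymbol J=w_xJ_x+w_yJ_y+w_zJ_z$. $[X,Y]=XY-YX$, $\{X,Y\}=XY+YX$; scalars in operator expressions stand for multiples of the identity; $\sqrt\rho$ is the positive semidefinite square root. For a Hermitian operator $X$ put $X_0=X-\operatorname{tr}(\rho X)$, $I(\rho,X)=\operatorname{tr}(\rho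 X^2)-\operatorname{tr}(\sqrt\rho X\sqrt\rho X)=\tfrac12\operatorname{tr}(i[\sqrt\rho,X_0])^2$ (Wigner–Yanase skew information), $J(\rho,X)=\tfrac12\operatorname{tr}\{\sqrt\rho,X_0\}^2$, and $U(\rho,X)=\sqrt{I(\rho,X)\,J(\rho,X)}$. The inequality $U(\rho,X)U(\rho,Y)\ge\frac14|\operatorname{tr}\rho[X,Y]|^2$ holds for all states $\rho$ and observables $X,Y$; the displayed relation is the case $X=J_{\boldsymbol n_1}$, $Y=J_{\boldsymbol n_2}$. Convention in (i): $0^0=1$, and for $s'^2=1$ the fraction $\frac{1-s'^2}{1-s'^{4j+2}}$ is read as its limit $\frac1{2j+1}$.
   Formalization: Forms (i)/(ii) and ''equality iff s,t exist'' are stated for equality with tr(ρJ_{n3})≠0, as they fail for some trivial 0=0 cases; condition (2) is supplemented by its mirror st=-1, v=0, since u=0 can fail when |s|<1; ''(1) or (2)'' as printed is asserted for |s|≥1. *)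

(* Defs.v *)
From HB Require Import structures.
From mathcomp Require Export all_boot all_order all_algebra.
From mathcomp Require Export sesquilinear spectral complex.
From mathcomp Require Export boolp classical_sets reals topology normedtype.
From mathcomp Require Export sequences trigo.

Set Implicit Arguments.
Unset Strict Implicit.
Unset Printing Implicit Defensive.

Export Order.TTheory GRing.Theory Num.Theory.
Export numFieldNormedType.Exports.
Local Open Scope classical_set_scope.
Local Open Scope complex_scope.
Local Open Scope ring_scope.
Local Open Scope sesquilinear_scope.

Section Operators.
Context {C : numClosedFieldType} {n : nat}.
Implicit Types A X rho : 'M[C]_n.

Definition psdmx A :=
  A \is hermsymmx /\ forall v : 'cV[C]_n, 0 <= (v ^t* *m A *m v) 0 0.

Definition density rho := psdmx rho /\ \tr rho = 1.

Definition commutator_mx A X : 'M[C]_n := A *m X - X *m A.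
Definition anticommutator_mx A X : 'M[C]_n := A *m X + X *m A.

(* Functional calculus: [A = P^-1 *m diag_mx D *m P] with [P] unitary, by
   [orthomx_spectralP].  For positive semidefinite [A] this is the positive
   semidefinite square root, see [sqrtmx_psd] and [sqrtmxK]. *)
Definition sqrtmx A : 'M[C]_n :=
  invmx (spectralmx A) *m diag_mx (map_mx sqrtC (spectral_diag A))
    *m spectralmx A.

Lemma psd_spectral_diag A i : psdmx A -> 0 <= spectral_diag A 0 i.
Proof.
move=> [hA pA].
have PU := spectral_unitarymx A.
have /orthomx_spectralP eA : A \is normalmx by apply: hermitian_normalmx.
move: eA PU; set P := spectralmx A; set D := spectral_diag A => eA PU.
have := pA (P ^t* *m delta_mx i 0).
rewrite eA invmx_unitary // trmx_mul map_mxM /= trmxCK.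
have PPt : P *m P ^t* = 1%:M by apply/unitarymxP.
set e := delta_mx i 0.
have -> : ((e ^t* *m P) *m (P ^t* *m diag_mx D *m P)) *m (P ^t* *m e) =
  e ^t* *m (P *m P ^t*) *m diag_mx D *m (P *m P^t*) *m e.
  by rewrite !mulmxA.
rewrite PPt !mulmx1 /e trmx_delta map_delta_mx /= -rowE.
by rewrite row_diag_mx -scalemxAl mul_delta_mx !mxE !eqxx mulr1.
Qed.

Lemma sqrtmx_psd A : psdmx A -> psdmx (sqrtmx A).
Proof.
move=> pA; have PU := spectral_unitarymx A.
rewrite /sqrtmx invmx_unitary //; set P := spectralmx A.
set D := map_mx sqrtC _.
have D_ge0 i : 0 <= D 0 i by rewrite mxE sqrtC_ge0 psd_spectral_diag.
split.
  rewrite is_hermitianmxE; apply/eqP; rewrite expr0 scale1r.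
  rewrite !trmx_mul !map_mxM /= trmxCK tr_diag_mx mulmxA.
  congr (_ *m _ *m _); apply/matrixP => i j; rewrite !mxE rmorphMn /=.
  by have := D_ge0 i; rewrite mxE => /geC0_conj ->.
move=> v; set w := P *m v.
have -> : v ^t* *m (P ^t* *m diag_mx D *m P) *m v = w ^t* *m diag_mx D *m w.
  by rewrite trmx_mul map_mxM /= !mulmxA.
rewrite mul_mx_diag mxE sumr_ge0 // => i _; have := D_ge0 i.
rewrite !mxE mulrAC => ?; rewrite mulr_ge0 //.
by rewrite [X in 0 <= X]mulrC mul_conjC_ge0.
Qed.

Lemma sqrtmxK A : psdmx A -> sqrtmx A *m sqrtmx A = A.
Proof.
move=> pA; have [hA _] := pA.
have /orthomx_spectralP {3}-> : A \is normalmx by apply: hermitian_normalmx.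
rewrite /sqrtmx !mulmxA mulmxK ?spectral_unit //; congr (_ *m _).
rewrite -mulmxA mulmx_diag; congr (_ *m diag_mx _).
by apply/rowP => i; rewrite !mxE -expr2 sqrtCK.
Qed.

Definition centered rho X : 'M[C]_n := X - (\tr (rho *m X))%:M.

Definition skew_info rho X : C :=
  \tr (rho *m (X *m X)) - \tr (sqrtmx rho *m X *m sqrtmx rho *m X).

Definition skew_coinfo rho X : C :=
  let W := anticommutator_mx (sqrtmx rho) (centered rho X) in
  2^-1 * \tr (W *m W).

Definition uncertainty rho X : C :=
  sqrtC (skew_info rho X * skew_coinfo rho X).

End Operators.

Definition dotr (R : realType) (u v : 'rV[R]_3) : R :=
  \sum_(k < 3) u 0 k * v 0 k.

Definition orthonormal_basis3 (R : realType) (n1 n2 n3 : 'rV[R]_3) :=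
  [/\ dotr n1 n1 = 1, dotr n2 n2 = 1 & dotr n3 n3 = 1] /\
  [/\ dotr n1 n2 = 0, dotr n1 n3 = 0 & dotr n2 n3 = 0].

Section Spin.
Context {R : realType} {d : nat}.
Local Notation C := R[i].
Local Notation mx := ('M[C]_d.+1).

(* The spin is [j = d / 2]; the index [k : 'I_d.+1] stands for the magnetic
   quantum number [m = j - k], so that [k = j - m]. *)
Definition spin_j : R := d%:R / 2.
Definition spin_m (k : 'I_d.+1) : R := spin_j - k%:R.

Definition dicke (k : 'I_d.+1) : 'cV[C]_d.+1 := delta_mx k 0.

Definition Jz : mx := \matrix_(a, b) if a == b then (spin_m b)%:C else 0.

Definition Jplus : mx := \matrix_(a, b)
  if spin_m a == spin_m b + 1
  then (Num.sqrt ((spin_j - spin_m b) * (spin_j + spin_m b + 1)))%:C else 0.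

Definition Jminus : mx := \matrix_(a, b)
  if spin_m a == spin_m b - 1
  then (Num.sqrt ((spin_j + spin_m b) * (spin_j - spin_m b + 1)))%:C else 0.

Definition Jx : mx := 2^-1 *: (Jplus + Jminus).
Definition Jy : mx := (2 * 'i)^-1 *: (Jplus - Jminus).

Definition Jdir (w : 'rV[R]_3) : mx :=
  (w 0 0)%:C *: Jx + (w 0 1)%:C *: Jy + (w 0 2)%:C *: Jz.

Definition mexp (A : mx) : mx :=
  limn (series (fun k => (k`!%:R)^-1 *: A ^+ k)).

Definition rotation (T : mx) := exists (theta : R) (w : 'rV[R]_3),
  dotr w w = 1 /\ T = mexp (- ('i * theta%:C) *: Jdir w).

Definition rotated_diagonal (rho : mx) := exists T D : mx,
  [/\ rotation T, is_diag_mx D & rho = T *m D *m T ^t*].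

Definition rotated_pure (rho : mx) := exists (T : mx) (psi : 'cV[C]_d.+1),
  [/\ rotation T, psi ^t* *m psi = 1%:M &
      rho = T *m (psi *m psi ^t*) *m T ^t*].

(* [k = j - n] and [d = 2j] give the exponents [2(j - n) = 2k] and
   [4j + 2 = 2(d + 1)]. *)
Definition geometric_weight (s : R) (k : 'I_d.+1) : R :=
  s ^+ (2 * k) *
  (if s ^+ 2 == 1 then (d.+1)%:R^-1
   else (1 - s ^+ 2) / (1 - s ^+ (2 * d.+1))).

Definition geometric_form (rho : mx) := exists (T : mx) (s : R),
  rotation T /\
  rho = \sum_(k < d.+1) (geometric_weight s k)%:C *:
          (T *m dicke k *m (dicke k) ^t* *m T ^t*).

Definition squeezed_form (rho : mx) :=
  exists (T : mx) (beta : R) (k : 'I_d.+1) (a : C),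
    let phi := a *: (T *m mexp (beta%:C *: Jz)
                       *m mexp (- ('i * (pi / 2)%:C) *: Jy) *m dicke k) in
    [/\ rotation T, phi ^t* *m phi = 1%:M & rho = phi *m phi ^t*].

Section Equality.
Variables (rho : mx) (n1 n2 n3 : 'rV[R]_3).

Definition minimum_uncertainty :=
  uncertainty rho (Jdir n1) * uncertainty rho (Jdir n2)
  = 4^-1 * `|\tr (rho *m Jdir n3)| ^+ 2.

Definition equality_equations (s t : R) :=
  ('i * s%:C) *: commutator_mx (sqrtmx rho) (Jdir n1)
    + anticommutator_mx (sqrtmx rho) (centered rho (Jdir n2)) = 0 /\
  ('i * t%:C) *: commutator_mx (sqrtmx rho) (Jdir n2)
    + anticommutator_mx (sqrtmx rho) (centered rho (Jdir n1)) = 0.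

End Equality.
End Spin.

(* Main.v *)
(* Let [r] be the square root of [rho], let [X, Y, Z] be the spin components
   along [n1, n2, n1 x n2] and put [A = i [r, X]], [B = {r, Y - <Y>}].  Since
   [tr (A B) = - tr (rho Z)], the uncertainty relation is the product of this
   Cauchy-Schwarz inequality and of the one with [X] and [Y] exchanged; equality
   with a nonzero right-hand side means that both are equalities, which gives
   the two equations with parameters [s] and [t].

   As statements on the superoperators acting on [r], the commutator of these
   equations is [(1 + s t) [Z, r] = 0].  If [Z] commutes with [r], applying
   [[Z, -]] gives [s = - t] and [<X> = <Y> = 0]; the equations then combine to
   [(1 + s) J+ r = (s - 1) r J+] and [(1 + s) r J- = (s - 1) J- r], so [r] is
   diagonal with a geometric spectrum of ratio [(s - 1) / (s + 1)].  If
   [s t = -1], they collapse to [(Y - i s X) r = l r], where [Y - i s X] is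
   conjugate to a real multiple of [Jz] if [|s| < 1] and is a raising operator
   if [s = 1]; its eigenspaces are lines, so [rho] is pure, and comparing [l]
   with the eigenvalues yields the conditions on the means.  Exchanging [n1] and
   [n2] exchanges [s] and [t], which reduces everything to [0 <= s] in the first
   case and to [-1 < s <= 1] in the second. *)

Require Import Defs.
From mathcomp Require Import exp ring lra.

Set Implicit Arguments.
Unset Strict Implicit.
Unset Printing Implicit Defensive.

Local Open Scope classical_set_scope.
Local Open Scope complex_scope.
Local Open Scope ring_scope.
Local Open Scope sesquilinear_scope.

(** * Matrix exponential *)

Section ComplexExponential.
Variable R : realType.
Local Notation C := (R[i] : numFieldType).

(** The complex exponential enters only through the convergence of its series: its values are needed
    at real and at imaginary arguments, where they have closed forms. *)
Definition has_cexp (z w : C) :=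
  series (fun k => (k`!%:R)^-1 * z ^+ k : C) @ \oo --> w.

Definition cis (x : R) : R[i] := (cos x)%:C + 'i * (sin x)%:C.

Lemma cvg_real_complex (u : nat -> R) (l : R) :
  u @ \oo --> l -> (fun n => (u n)%:C : C) @ \oo --> (l%:C : C).
Proof.
move=> /cvgrPdist_lt ul; apply/cvgrPdist_lt => e e0.
have eE : e = (complex.Re e)%:C by rewrite RRe_real // ger0_real // ltW.
have e1 : 0 < complex.Re e by rewrite -ltcR -eE.
have := ul _ e1; apply: filterS => n /=.
rewrite -rmorphB /= normc_def /= expr0n addr0 sqrtr_sqr eE ltcR.
by [].
Qed.

Lemma has_cexp_real (x : R) : has_cexp x%:C (expR x)%:C.
Proof.
rewrite /has_cexp.
have -> : series (fun k => (k`!%:R)^-1 * (x%:C : R[i]) ^+ k) =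
          (fun n => (series (exp_coeff x) n)%:C).
  apply/funext => n; rewrite /series /= rmorph_sum; apply: eq_bigr => k _.
  by rewrite /exp_coeff /= rmorphM rmorphXn fmorphV rmorph_nat mulrC.
exact/cvg_real_complex/is_cvg_series_exp_coeff.
Qed.

(** The parity factors are those of [cos_coeff] and [sin_coeff], so that the series in
    [has_cexp_imag] splits term by term. *)
Lemma expi (k : nat) : ('i : R[i]) ^+ k =
  ((~~ odd k)%:R * (-1) ^+ k./2 + 'i * ((odd k)%:R * (-1) ^+ k.-1./2)).
Proof.
have i2 m : ('i : R[i]) ^+ (m.*2) = (-1) ^+ m by rewrite -mul2n exprM sqrCi.
rewrite -{1}(odd_double_half k) exprD i2; case: (boolP (odd k)) => ok /=.
  have -> : (k.-1./2 = k./2)%N by rewrite -{1}(odd_double_half k) ok /= doubleK.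
  by rewrite expr1 !mul0r mul1r add0r.
by rewrite expr0 !mul1r !mul0r mulr0 addr0.
Qed.

Lemma has_cexp_imag (x : R) : has_cexp ('i * x%:C) (cis x).
Proof.
rewrite /has_cexp.
have -> : series (fun k => (k`!%:R)^-1 * ('i * (x%:C : R[i])) ^+ k) =
   (fun n => (series (cos_coeff x) n)%:C + 'i * (series (sin_coeff x) n)%:C).
  apply/funext => n; rewrite /series /= !rmorph_sum mulr_sumr -big_split /=.
  apply: eq_bigr => k _; rewrite /cos_coeff /sin_coeff /= exprMn expi.
  rewrite !rmorphM /= !rmorphXn /= !fmorphV /= !rmorph_nat rmorphN1.
  by ring.
apply: cvgD.
  apply: cvg_real_complex; rewrite unlock; exact: is_cvg_series_cos_coeff.
apply: cvgM; first exact: cvg_cst.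
apply: cvg_real_complex; rewrite unlock; exact: is_cvg_series_sin_coeff.
Qed.

(** In the eigenbasis the partial sums of the matrix series are finite combinations of the fixed
    matrices [Pi *m delta_mx i i *m P], whose coefficients are partial sums of scalar exponential
    series. The limit is therefore taken coefficient by coefficient. *)
Lemma mexp_diagonalized (d : nat) (P Pi : 'M[R[i]]_d.+1) (D f : 'rV[R[i]]_d.+1)
    (z : R[i]) : P *m Pi = 1%:M ->
  (forall i, has_cexp (z * D 0 i) (f 0 i)) ->
  mexp (z *: (Pi *m diag_mx D *m P)) = Pi *m diag_mx f *m P.
Proof.
move=> PPi zDf.
have powE k : (z *: (Pi *m diag_mx D *m P)) ^+ k.+1 =
    Pi *m diag_mx (\row_i (z * D 0 i) ^+ k.+1) *m P.
  elim: k => [|k IH].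
    rewrite expr1 scalemxAl scalemxAr; congr (_ *m _ *m _).
    by apply/matrixP => i j; rewrite !mxE expr1 mulrnAr.
  rewrite exprS IH -[LHS]/(_ *m _) scalemxAl scalemxAr.
  rewrite -!mulmxA (mulmxA P) PPi mul1mx; congr (_ *m _).
  rewrite !mulmxA; congr (_ *m _); rewrite -scalemxAl mulmx_diag.
  by apply/matrixP => i j; rewrite !mxE mulrnAr mulrA -exprS.
have PiP : Pi *m P = 1%:M by exact: mulmx1C.

have pow k : (z *: (Pi *m diag_mx D *m P)) ^+ k =
    Pi *m diag_mx (\row_i (z * D 0 i) ^+ k) *m P.
  case: k => [|k]; last exact: powE.
  rewrite expr0 (_ : \row_i _ = const_mx 1); last by apply/rowP => i; rewrite !mxE.
  by rewrite diag_const_mx mulmx1 PiP.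
have expand (v : 'rV[R[i]]_d.+1) : Pi *m diag_mx v *m P =
    \sum_i v 0 i *: (Pi *m delta_mx i i *m P).
  rewrite diag_mx_sum_delta mulmx_sumr mulmx_suml; apply: eq_bigr => i _.
  by rewrite -scalemxAr -scalemxAl.
rewrite /mexp.
have -> : series (fun k => (k`!%:R)^-1 *: (z *: (Pi *m diag_mx D *m P)) ^+ k) =
  (fun n => \sum_(i < d.+1) (series (fun k => (k`!%:R)^-1 * (z * D 0 i) ^+ k : C) n)
      *: (Pi *m delta_mx i i *m P)).
  apply/funext => n; rewrite /series /=.
  under eq_bigr do rewrite pow expand scaler_sumr.
  rewrite exchange_big /=; apply: eq_bigr => i _.
  rewrite scaler_suml; apply: eq_bigr => k _.
  by rewrite mxE scalerA.
apply: (cvg_lim (@norm_hausdorff C _)); rewrite expand; apply: cvg_big => [[a b]|i _]; [exact: add_continuous|].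
apply: (cvgZr_tmp (zDf i)).
Qed.
End ComplexExponential.

(** * Entrywise identities and adjoints *)

Lemma mxDE (K : zmodType) m n (A B : 'M[K]_(m, n)) i j : (A + B) i j = A i j + B i j.
Proof. by rewrite mxE. Qed.

Lemma mxNE (K : zmodType) m n (A : 'M[K]_(m, n)) i j : (- A) i j = - A i j.
Proof. by rewrite mxE. Qed.

Lemma mxZE (K : pzRingType) m n (c : K) (A : 'M[K]_(m, n)) i j :
  (c *: A) i j = c * A i j.
Proof. by rewrite mxE. Qed.

Definition mxlinE := (mxDE, mxNE, mxZE).

(** Prepares a goal for [mxlin]: scalars move out of the products, and only products of atoms
    remain. *)
Definition mxexpand (K : comPzRingType) := (@mulmxDl K, @mulmxDr K, @mulmxBl K,
  @mulmxBr K, @mulNmx K, @mulmxN K, fun m n p a A B => esym (@scalemxAl K m n p a A B),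
  fun m n p a A B => esym (@scalemxAr K m n p a A B)).

Section Adjoint.
Variable C : numClosedFieldType.

Lemma adjmxD m n (A B : 'M[C]_(m, n)) : (A + B)^t* = A^t* + B^t*.
Proof. by rewrite linearD /= map_mxD. Qed.

Lemma adjmxN m n (A : 'M[C]_(m, n)) : (- A)^t* = - A^t*.
Proof. by rewrite linearN /= map_mxN. Qed.

Lemma adjmxZ m n c (A : 'M[C]_(m, n)) : (c *: A)^t* = c^* *: A^t*.
Proof. by rewrite linearZ /= map_mxZ. Qed.

Lemma adjmxM m n p (A : 'M[C]_(m, n)) (B : 'M[C]_(n, p)) :
  (A *m B)^t* = B^t* *m A^t*.
Proof. by rewrite trmx_mul map_mxM. Qed.

Lemma hermsymmxP n (A : 'M[C]_n) : (A \is hermsymmx) <-> (A^t* = A).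
Proof.
rewrite is_hermitianmxE expr0 scale1r; split=> [/eqP //|->]; exact: eqxx.
Qed.

End Adjoint.

(* Products are generalized to variables, so that a linear identity between
   them can be checked entrywise. *)
Ltac mxlin := repeat (match goal with |- context [?A *m ?B] =>
    let M := fresh "M" in move: (A *m B) => M end);
  apply/matrixP => ? ?; rewrite !mxlinE;
  repeat (match goal with |- context [fun_of_matrix ?A ?x ?y] =>
    let e := fresh "e" in move: (A x y) => e end).

(** Only the three commutation relations enter, as rules that bring the products [X Y], [Y Z] and
    [Z X] into a fixed order; the coefficients that remain are those of the cross product. *)
Lemma comm_so3 (C : numClosedFieldType) n (X Y Z : 'M[C]_n) a b c a' b' c' :
  X *m Y - Y *m X = 'i *: Z -> Y *m Z - Z *m Y = 'i *: X ->
  Z *m X - X *m Z = 'i *: Y ->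
  (a *: X + b *: Y + c *: Z) *m (a' *: X + b' *: Y + c' *: Z) -
  (a' *: X + b' *: Y + c' *: Z) *m (a *: X + b *: Y + c *: Z) =
  'i *: ((b * c' - c * b') *: X + (c * a' - a * c') *: Y + (a * b' - b * a') *: Z).
Proof.
move=> /(canRL (subrK _)) xy /(canRL (subrK _)) yz /(canRL (subrK _)) zx.
rewrite !mxexpand xy yz zx.
by mxlin; ring.
Qed.

(** * Angular momentum algebra *)

Section SpinAlgebra.
Variables (R : realType) (d : nat).
Local Notation mx := ('M[R[i]]_d.+1).
Local Notation Jx := (@Jx R d).
Local Notation Jy := (@Jy R d).
Local Notation Jz := (@Jz R d).
Local Notation Jplus := (@Jplus R d).
Local Notation Jminus := (@Jminus R d).

(** With [k = j - m] the factor [(j - m) (j + m + 1)] of the raising operator becomes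
    [k (d + 1 - k)]. Its zeros at [0] and [d + 1] end the ladder on both sides. *)
Definition ladder (k : nat) : R := Num.sqrt (k%:R * (d.+1%:R - k%:R)).

Lemma ladder0 : ladder 0 = 0.
Proof. by rewrite /ladder mul0r sqrtr0. Qed.

Lemma ladderS : ladder d.+1 = 0.
Proof. by rewrite /ladder subrr mulr0 sqrtr0. Qed.

Lemma ladder_sqr k : (k <= d.+1)%N -> ladder k ^+ 2 = k%:R * (d.+1%:R - k%:R).
Proof.
by move=> kd; rewrite sqr_sqrtr // mulr_ge0 // subr_ge0 ler_nat.
Qed.

Lemma ladder_neq0 k : (0 < k <= d)%N -> ladder k != 0.
Proof.
move=> /andP[k0 kd]; rewrite gt_eqF // sqrtr_gt0 mulr_gt0 ?ltr0n //.
by rewrite subr_gt0 ltr_nat.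
Qed.

Lemma mul_JzE n (M : 'M[R[i]]_(d.+1, n)) a b :
  (Jz *m M) a b = (spin_m a)%:C * M a b.
Proof.
rewrite (_ : Jz = diag_mx (\row_b (spin_m b)%:C)) ?mul_diag_mx ?mxE //.
by apply/matrixP => x y; rewrite !mxE; case: eqP => [->|].
Qed.

Lemma mul_mx_JzE n (M : 'M[R[i]]_(n, d.+1)) a b :
  (M *m Jz) a b = M a b * (spin_m b)%:C.
Proof.
rewrite (_ : Jz = diag_mx (\row_b (spin_m b)%:C)) ?mul_mx_diag ?mxE //.
by apply/matrixP => x y; rewrite !mxE; case: eqP => [->|].
Qed.

Lemma JplusE a b : Jplus a b = if b == a.+1 :> nat then (ladder b)%:C else 0.
Proof.
rewrite mxE /spin_m /spin_j; congr (if _ then _%:C else _).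
  rewrite -(eqr_nat R) -natr1; apply/eqP/eqP => ?; lra.
by congr (Num.sqrt _); rewrite -natr1; field.
Qed.

Lemma JminusE a b : Jminus a b = if a == b.+1 :> nat then (ladder a)%:C else 0.
Proof.
rewrite mxE /spin_m /spin_j.
have -> : (d%:R / 2 - a%:R == d%:R / 2 - b%:R - 1 :> R) = (a == b.+1 :> nat).
  rewrite -(eqr_nat R) -natr1; apply/eqP/eqP => ?; lra.
case: eqP => // ->; congr (Num.sqrt _)%:C.
by rewrite -!natr1; field.
Qed.

(** In the last row [inord a.+1] is out of range and takes a default value, which is harmless
    because [ladder d.+1] is zero. Row [0] of [mul_JminusE] is covered by [ladder 0 = 0] in the same
    way. *)
Lemma mul_JplusE n (M : 'M[R[i]]_(d.+1, n)) a b :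
  (Jplus *m M) a b = (ladder a.+1)%:C * M (inord a.+1) b.
Proof.
have [ad|da] := ltnP a d.
  rewrite mxE (bigD1 (inord a.+1)) //= JplusE inordK // eqxx big1 ?addr0 //.
  move=> c /eqP ca; rewrite JplusE; case: eqP => [cE|_]; last by rewrite mul0r.
  by case: ca; apply: val_inj; rewrite /= inordK.
have aE : a = d :> nat by apply/eqP; rewrite eqn_leq da -ltnS ltn_ord.
rewrite aE ladderS mul0r mxE big1 // => c _; rewrite JplusE aE.
by rewrite ltn_eqF ?mul0r.
Qed.

Lemma mul_JminusE n (M : 'M[R[i]]_(d.+1, n)) a b :
  (Jminus *m M) a b = (ladder a)%:C * M (inord a.-1) b.
Proof.
case: (posnP a) => [a0|a0].
  rewrite a0 ladder0 mul0r mxE big1 // => c _; rewrite JminusE a0.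
  by rewrite mul0r.
have ad : (a.-1 < d.+1)%N by rewrite (leq_ltn_trans (leq_pred a)).
rewrite mxE (bigD1 (inord a.-1)) //= JminusE inordK // prednK // eqxx big1 ?addr0 //.
move=> c /eqP ca; rewrite JminusE; case: eqP => [cE|_]; last by rewrite mul0r.
by case: ca; apply: val_inj; rewrite /= inordK // cE.
Qed.

Lemma comm_Jz_Jplus : Jz *m Jplus - Jplus *m Jz = Jplus.
Proof.
apply/matrixP => a b; rewrite mxDE mxNE mul_JzE mul_mx_JzE.
rewrite JplusE; case: eqP => [ba|_]; last by rewrite mulr0 mul0r subr0.
rewrite [X in _ - X]mulrC -mulrBl -rmorphB /= /spin_m ba -natr1.
by rewrite (_ : _ - _ = 1 :> R) ?mul1r //; ring.
Qed.

Lemma comm_Jz_Jminus : Jz *m Jminus - Jminus *m Jz = - Jminus.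
Proof.
apply/matrixP => a b; rewrite !mxlinE mul_JzE mul_mx_JzE.
rewrite JminusE; case: eqP => [ba|_]; last by rewrite mulr0 mul0r subr0 oppr0.
rewrite [X in _ - X]mulrC -mulrBl -rmorphB /= /spin_m ba -natr1.
by rewrite (_ : _ - _ = -1 :> R) ?rmorphN1 ?mulN1r //; ring.
Qed.

(** Both products are diagonal, with entries [ladder a.+1 ^+ 2] and [ladder a ^+ 2]; their
    difference is [d - 2 a], twice the magnetic quantum number. *)
Lemma comm_Jplus_Jminus : Jplus *m Jminus - Jminus *m Jplus = 2 *: Jz.
Proof.
apply/matrixP => a b; rewrite !mxlinE mul_JplusE mul_JminusE JplusE JminusE.
have -> : (ladder a.+1)%:C *
    (if (inord a.+1 : 'I_d.+1) == b.+1 :> nat then (ladder (inord a.+1 : 'I_d.+1))%:C else 0)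
    = (a == b)%:R * (ladder a.+1 ^+ 2)%:C :> R[i].
  have [ad|da] := ltnP a d.
    rewrite inordK // eqSS val_eqE; case: eqP => _; first by rewrite mul1r rmorphXn.
    by rewrite mulr0 mul0r.
  have -> : a = d :> nat by apply/eqP; rewrite eqn_leq da -ltnS ltn_ord.
  by rewrite ladderS mul0r expr0n mulr0.
have -> : (ladder a)%:C *
    (if b == (inord a.-1 : 'I_d.+1).+1 :> nat then (ladder b)%:C else 0)
    = (a == b)%:R * (ladder a ^+ 2)%:C :> R[i].
  case: (posnP a) => [->|a0]; first by rewrite ladder0 mul0r expr0n mulr0.
  rewrite inordK ?prednK //; last by rewrite ltnW ?ltn_ord.
  rewrite eq_sym val_eqE; case: eqP => [<-|_]; first by rewrite mul1r rmorphXn.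
  by rewrite mulr0 mul0r.
have -> : Jz a b = if a == b then (spin_m b)%:C else 0 by rewrite mxE.
case: eqP => [->|_]; last by rewrite !mul0r subr0 mulr0.
rewrite !mul1r -rmorphB /= -[2]/(2%:R) -(rmorph_nat (real_complex R) 2) -rmorphM /=.
congr (_%:C); rewrite !ladder_sqr ?ltn_ord // ?(ltnW (ltn_ord _)) //.
by rewrite /spin_m /spin_j -!natr1; field.
Qed.

Lemma JyE : Jy = (- ('i / 2)) *: (Jplus - Jminus).
Proof.
rewrite /Defs.Jy; congr (_ *: _); rewrite invfM invCi; by field.
Qed.

Lemma comm_Jx_Jy : Jx *m Jy - Jy *m Jx = 'i *: Jz.
Proof.
rewrite JyE /Defs.Jx !mxexpand.
have -> : Jplus *m Jminus = Jminus *m Jplus + 2 *: Jz.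
  by rewrite -comm_Jplus_Jminus addrC subrK.
by move: Jplus Jminus Jz => P M Z; mxlin; field.
Qed.

Lemma Jz_JplusE : Jz *m Jplus = Jplus *m Jz + Jplus.
Proof. by rewrite -{3}comm_Jz_Jplus addrC subrK. Qed.

Lemma Jz_JminusE : Jz *m Jminus = Jminus *m Jz - Jminus.
Proof. by rewrite -comm_Jz_Jminus addrC subrK. Qed.

Lemma comm_Jy_Jz : Jy *m Jz - Jz *m Jy = 'i *: Jx.
Proof.
rewrite JyE /Defs.Jx !mxexpand Jz_JplusE Jz_JminusE.
by move: Jplus Jminus Jz => P M Z; mxlin; field.
Qed.

Lemma comm_Jz_Jx : Jz *m Jx - Jx *m Jz = 'i *: Jy.
Proof.
rewrite JyE /Defs.Jx !mxexpand Jz_JplusE Jz_JminusE.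
rewrite scalerA mulrN mulrA -expr2 sqrCi.
by move: Jplus Jminus Jz => P M Z; mxlin; field.
Qed.

Lemma Jplus_decomp : Jplus = Jx + 'i *: Jy.
Proof.
rewrite JyE /Defs.Jx scalerA mulrN mulrA -expr2 sqrCi.
by move: Jplus Jminus Jz => P M Z; mxlin; field.
Qed.

Lemma Jminus_decomp : Jminus = Jx - 'i *: Jy.
Proof.
rewrite JyE /Defs.Jx scalerA mulrN mulrA -expr2 sqrCi.
by move: Jplus Jminus Jz => P M Z; mxlin; field.
Qed.

Lemma adj_Jplus : Jplus^t* = Jminus.
Proof.
apply/matrixP => a b; rewrite mxE [_^T _ _]mxE JplusE JminusE.
case: eqP => _; last by rewrite conjC0.
exact: conjc_real.
Qed.

Lemma adj_Jminus : Jminus^t* = Jplus.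
Proof. by rewrite -adj_Jplus trmxCK. Qed.

Lemma conj_real_complex (x : R) : (x%:C : R[i])^* = x%:C.
Proof. exact: conjc_real. Qed.

Lemma adj_Jx : Jx^t* = Jx.
Proof.
rewrite /Defs.Jx adjmxZ adjmxD adj_Jplus adj_Jminus addrC.
by rewrite (_ : _^* = 2^-1) // fmorphV rmorph_nat.
Qed.

Lemma adj_Jy : Jy^t* = Jy.
Proof.
rewrite JyE adjmxZ adjmxD adjmxN adj_Jplus adj_Jminus.
rewrite rmorphN rmorphM /= conjCi fmorphV rmorph_nat.
by move: Jplus Jminus => P M; mxlin; ring.
Qed.

Lemma adj_Jz : Jz^t* = Jz.
Proof.
apply/matrixP => a b; rewrite mxE [_^T _ _]mxE [Jz b a]mxE [Jz a b]mxE eq_sym.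
case: eqP => [->|_]; last by rewrite conjC0.
exact: conj_real_complex.
Qed.

Definition row3 (a b c : R) : 'rV[R]_3 := \row_k [:: a; b; c]`_k.

Definition cross (v w : 'rV[R]_3) : 'rV[R]_3 :=
  row3 (v 0 1 * w 0 2 - v 0 2 * w 0 1) (v 0 2 * w 0 0 - v 0 0 * w 0 2)
       (v 0 0 * w 0 1 - v 0 1 * w 0 0).

Lemma adj_Jdir v : (@Jdir R d v)^t* = Jdir v.
Proof.
rewrite /Jdir; move: adj_Jx adj_Jy adj_Jz.
move: Jx Jy Jz => X Y Z hX hY hZ.
by rewrite !adjmxD !adjmxZ hX hY hZ !conj_real_complex.
Qed.

Lemma Jdir_lin a v w : @Jdir R d (a *: v + w) = a%:C *: Jdir v + Jdir w.
Proof.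
rewrite /Jdir !mxE !rmorphD !rmorphM /=; move: Jx Jy Jz => X Y Z.
move: a%:C (v 0 0)%:C (v 0 1)%:C (v 0 2)%:C (w 0 0)%:C (w 0 1)%:C (w 0 2)%:C.
move=> *.
by mxlin; ring.
Qed.

Lemma comm_Jdir v w :
  @Jdir R d v *m Jdir w - Jdir w *m Jdir v = 'i *: Jdir (cross v w).
Proof.
rewrite /Jdir (comm_so3 _ _ _ _ _ _ comm_Jx_Jy comm_Jy_Jz comm_Jz_Jx).
by rewrite !mxE /= !(rmorphB, rmorphM).
Qed.

End SpinAlgebra.

(** * Intertwining relations for exponentials of Hermitian matrices *)

Lemma conj_intertwine (C : numClosedFieldType) n (P P' B G : 'M[C]_n) k :
  P *m P' = 1%:M -> G *m B = k *: (B *m G) ->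
  (P' *m G *m P) *m (P' *m B *m P) = k *: ((P' *m B *m P) *m (P' *m G *m P)).
Proof.
move=> PP GB; rewrite -!mulmxA !(mulmxA P P') PP !mul1mx (mulmxA G) GB.
by rewrite -scalemxAl -scalemxAr !mulmxA.
Qed.

Section HermitianExponential.
Variables (R : realType) (d : nat).
Local Notation mx := ('M[R[i]]_d.+1).
Implicit Types H B P : mx.

(** What rotations ([z] imaginary) and boosts ([z] real) share: [g x] is the exponential of [z x] on
    real eigenvalues [x], together with the addition law. *)
Definition exp_param (z : R[i]) (g : R -> R[i]) :=
  [/\ forall x : R, has_cexp (z * x%:C) (g x), g 0 = 1 &
      forall x y, g (x + y) = g x * g y].

Lemma cisD (x y : R) : cis (x + y) = cis x * cis y.
Proof.
rewrite /cis cosD sinD rmorphB rmorphD !rmorphM /=.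
move: (cos x)%:C (cos y)%:C (sin x)%:C (sin y)%:C => a b c e.
transitivity (a * b + 'i ^+ 2 * (c * e) + 'i * (c * b + a * e)); last by ring.
by rewrite sqrCi; ring.
Qed.

Lemma cisN (x : R) : cis (- x) = (cis x)^*.
Proof.
rewrite /cis cosN sinN rmorphD rmorphM /= conjCi !conj_real_complex rmorphN /=.
by ring.
Qed.

Lemma cis_normal (x : R) : cis x * (cis x)^* = 1.
Proof. by rewrite -cisN -cisD subrr /cis cos0 sin0 mulr0 addr0. Qed.

Lemma exp_param_rotation (theta : R) :
  exp_param (- ('i * theta%:C)) (fun x => cis (- (theta * x))).
Proof.
split=> [x||x y]; last by rewrite mulrDr opprD cisD.
  have -> : - ('i * theta%:C) * x%:C = 'i * (- (theta * x))%:C :> R[i].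
    by rewrite rmorphN rmorphM /=; ring.
  exact: has_cexp_imag.
by rewrite mulr0 oppr0 /cis cos0 sin0 mulr0 addr0.
Qed.

Lemma exp_param_boost (b : R) : exp_param b%:C (fun x => (expR (b * x))%:C).
Proof.
split=> [x||x y]; first by rewrite -rmorphM; exact: has_cexp_real.
  by rewrite mulr0 expR0.
by rewrite mulrDr exp.expRD rmorphM.
Qed.

Lemma hermitian_spectral H : H^t* = H -> exists P x,
  P *m P^t* = 1%:M /\ H = P^t* *m diag_mx (map_mx (real_complex R) x) *m P.
Proof.
move=> hH; have hS : H \is hermsymmx by apply/hermsymmxP.
have /orthomx_spectralP eH := hermitian_normalmx hS.
have PU := spectral_unitarymx H.
exists (spectralmx H), (map_mx (@complex.Re R) (spectral_diag H)).
split; first exact/unitarymxP.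
set D := map_mx (real_complex R) _; suff -> : D = spectral_diag H.
  by rewrite {1}eH (invmx_unitary PU).
apply/rowP => i; rewrite !mxE.
have /mxOverP /(_ 0 i) /RRe_real // := hermitian_spectral_diag_real hS.
Qed.

Variables (z : R[i]) (g : R -> R[i]).
Hypothesis zg : exp_param z g.

Lemma mexp_hermitian H : H^t* = H -> exists P x,
  [/\ P *m P^t* = 1%:M, H = P^t* *m diag_mx (map_mx (real_complex R) x) *m P &
      mexp (z *: H) = P^t* *m diag_mx (map_mx g x) *m P].
Proof.
move=> /hermitian_spectral[P [x [PP ->]]]; exists P, x; split=> //.
apply: mexp_diagonalized => // i; rewrite !mxE; have [+ _ _] := zg; exact.
Qed.

Lemma exp_paramN x : g x * g (- x) = 1.
Proof. by have [_ g0 gD] := zg; rewrite -gD subrr. Qed.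

Lemma mexp_unitmx H : H^t* = H -> mexp (z *: H) \in unitmx.
Proof.
move=> /mexp_hermitian[P [x [PP _ ->]]].
pose D y := P^t* *m diag_mx (map_mx g y) *m P.
suff DD : D x *m D (- x) = 1%:M.
  by have [U _] := mulmx1_unit DD; exact: U.
have PP' : P^t* *m P = 1%:M by apply: mulmx1C.
rewrite /D -!mulmxA (mulmxA P) PP mul1mx (mulmxA (diag_mx _)) mulmx_diag.
rewrite (_ : \row_j _ = const_mx 1); first by rewrite diag_const_mx mul1mx.
by apply/rowP => i; rewrite !mxE exp_paramN.
Qed.

Lemma mexp_unitary H : H^t* = H -> (forall x, g x * (g x)^* = 1) ->
  mexp (z *: H) *m (mexp (z *: H))^t* = 1%:M.
Proof.
move=> /mexp_hermitian[P [x [PP _ ->]]] gN.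
have PP' : P^t* *m P = 1%:M by apply: mulmx1C.
rewrite !adjmxM trmxCK -!mulmxA (mulmxA P) PP mul1mx (mulmxA (diag_mx _)).
rewrite tr_diag_mx map_diag_mx mulmx_diag (_ : \row_j _ = const_mx 1).
  by rewrite diag_const_mx mul1mx.
by apply/rowP => i; rewrite !mxE gN.
Qed.

(* In an eigenbasis of [H] the matrix [B] shifts the eigenvalue by [c], and
   [g] turns the shift into a factor. *)
Lemma mexp_intertwine H B c : H^t* = H -> H *m B - B *m H = c%:C *: B ->
  mexp (z *: H) *m B = g c *: (B *m mexp (z *: H)).
Proof.
move=> /mexp_hermitian[P [x [PP hH ->]]] hB.
have PP' : P^t* *m P = 1%:M by apply: mulmx1C.
set D := diag_mx (map_mx (real_complex R) x) in hH.
pose B' := P *m B *m P^t*.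
have BE : B = P^t* *m B' *m P.
  by rewrite /B' !mulmxA PP' mul1mx -mulmxA PP' mulmx1.
have hB' : D *m B' - B' *m D = c%:C *: B'.
  have := congr1 (fun M => P *m M *m P^t*) hB.
  rewrite -scalemxAr -scalemxAl -/B' => <-.
  rewrite mulmxBr mulmxBl hH /B'; congr (_ - _).
    by rewrite !mulmxA PP mul1mx.
  by rewrite !mulmxA -(mulmxA _ P (P^t*)) PP mulmx1.
clearbody B'.
have gB' : diag_mx (map_mx g x) *m B' = g c *: (B' *m diag_mx (map_mx g x)).
  apply/matrixP => i j; rewrite mul_diag_mx mul_mx_diag 2!mxE mxZE 2!mxE.
  have /matrixP /(_ i j) := hB'.
  rewrite mul_diag_mx mul_mx_diag mxDE mxNE mxZE 2![(\matrix_(_, _) _) _ _]mxE.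
  rewrite ![map_mx _ _ _ _]mxE.
  rewrite [X in _ - X]mulrC -mulrBl -rmorphB => /eqP.
  rewrite -subr_eq0 -mulrBl mulf_eq0 -rmorphB => /orP[|/eqP ->].
    rewrite fmorph_eq0 subr_eq0 subr_eq => /eqP ->.
    have [_ _ ->] := zg; by rewrite -mulrA (mulrC (B' i j)).
  by rewrite !(mul0r, mulr0).
move: (diag_mx _) gB' => G gB'.
by rewrite BE; apply: conj_intertwine.
Qed.

End HermitianExponential.

(** * Rotations *)

Section Rotations.
Variables (R : realType) (d : nat).
Local Notation mx := ('M[R[i]]_d.+1).
Local Notation Jd := (@Jdir R d).

Lemma dotrE (u v : 'rV[R]_3) :
  dotr u v = u 0 0 * v 0 0 + u 0 1 * v 0 1 + u 0 2 * v 0 2.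
Proof.
rewrite /dotr 3!big_ord_recl big_ord0 addr0 addrA.
by congr (_ + _ * _ + _ * _); congr (fun_of_matrix _ _ _); apply: val_inj.
Qed.

Lemma row3P (u v : 'rV[R]_3) :
  u 0 0 = v 0 0 -> u 0 1 = v 0 1 -> u 0 2 = v 0 2 -> u = v.
Proof.
move=> e0 e1 e2; apply/rowP => k.
case: k => [[|[|[|//]]] kP].
- by rewrite (_ : Ordinal kP = 0) //; apply: val_inj.
- by rewrite (_ : Ordinal kP = 1) //; apply: val_inj.
- by rewrite (_ : Ordinal kP = 2) //; apply: val_inj.
Qed.

Lemma row3E a b c : ((row3 a b c : 'rV[R]_3) 0 0 = a) *
  ((row3 a b c : 'rV[R]_3) 0 1 = b) * ((row3 a b c : 'rV[R]_3) 0 2 = c).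
Proof. by rewrite !mxE. Qed.

Lemma crossE (u v : 'rV[R]_3) :
  (cross u v 0 0 = u 0 1 * v 0 2 - u 0 2 * v 0 1) *
  (cross u v 0 1 = u 0 2 * v 0 0 - u 0 0 * v 0 2) *
  (cross u v 0 2 = u 0 0 * v 0 1 - u 0 1 * v 0 0).
Proof. by rewrite /cross !row3E. Qed.

Lemma dotr_crossl (u v : 'rV[R]_3) : dotr u (cross u v) = 0.
Proof. by rewrite dotrE !crossE; ring. Qed.

Lemma dotr_crossr (u v : 'rV[R]_3) : dotr v (cross u v) = 0.
Proof. by rewrite dotrE !crossE; ring. Qed.

Lemma dotr_cross_cross (u v : 'rV[R]_3) :
  dotr (cross u v) (cross u v) = dotr u u * dotr v v - dotr u v ^+ 2.
Proof. by rewrite !dotrE !crossE; ring. Qed.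

Lemma cross_cross (u v : 'rV[R]_3) :
  cross u (cross u v) = dotr u v *: u - dotr u u *: v.
Proof. by apply: row3P; rewrite !crossE !mxlinE !dotrE; ring. Qed.

Lemma det_mx33 (K : comPzRingType) (A : 'M[K]_3) : \det A =
  A 0 0 * (A 1 1 * A 2 2 - A 1 2 * A 2 1) - A 0 1 * (A 1 0 * A 2 2 - A 1 2 * A 2 0) +
  A 0 2 * (A 1 0 * A 2 1 - A 1 1 * A 2 0).
Proof.
(* With natural numbers as indices, the lifted ordinals of the cofactors reduce to numerals by
   computation. *)
pose B (i j : nat) := A (inord i) (inord j).
have AE i j : A i j = B i j by rewrite /B !inord_val.
rewrite (expand_det_row _ ord0) !big_ord_recl big_ord0 /cofactor.
rewrite !(expand_det_row _ ord0) !big_ord_recl !big_ord0 /cofactor !det_mx11 !mxE.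
rewrite !AE /= /bump /=; ring.
Qed.

Lemma cross_combination (a b c : 'rV[R]_3) (p q r p' q' r' : R) :
  cross (p *: a + q *: b + r *: c) (p' *: a + q' *: b + r' *: c) =
  (p * q' - q * p') *: cross a b + (q * r' - r * q') *: cross b c +
  (r * p' - p * r') *: cross c a.
Proof. by apply: row3P; rewrite ?crossE ?mxlinE ?crossE; ring. Qed.

(** The vectors are rows, so that [x *m frame a b c] is the image of [x] under the linear map that
    sends the coordinate axes to [a], [b], [c]. *)
Definition frame (a b c : 'rV[R]_3) : 'M[R]_3 := \matrix_(k, l) ([:: a; b; c]`_k) 0 l.

Lemma mul_frameE a b c x :
  x *m frame a b c = x 0 0 *: a + x 0 1 *: b + x 0 2 *: c.
Proof.
rewrite mulmx_sum_row 3!big_ord_recl big_ord0 addr0 addrA.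
congr (_ *: _ + _ *: _ + _ *: _); try by apply/rowP => l; rewrite !mxE.
  by congr (x 0 _); apply: val_inj.
by congr (x 0 _); apply: val_inj.
Qed.

Section Frame.
Variables a b : 'rV[R]_3.
Hypotheses (aa : dotr a a = 1) (bb : dotr b b = 1) (ab : dotr a b = 0).
Let c := cross a b.
Let Q := frame a b c.

Lemma frame_orthogonal : Q *m Q^T = 1%:M.
Proof.
have cc : dotr c c = 1 by rewrite dotr_cross_cross aa bb ab mulr1 expr0n subr0.
have QE i j : (Q *m Q^T) i j = dotr ([:: a; b; c]`_i) ([:: a; b; c]`_j).
  by rewrite mxE; apply: eq_bigr => k _; rewrite !mxE.
have dC (u v : 'rV[R]_3) : dotr u v = dotr v u by rewrite !dotrE; ring.
apply/matrixP => i j; rewrite QE mxE.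
have ac : dotr a c = 0 by exact: dotr_crossl.
have bc : dotr b c = 0 by exact: dotr_crossr.
case: i => [[|[|[|//]]] ?]; case: j => [[|[|[|//]]] ?] //=; by rewrite dC.
Qed.

Lemma frame_orthogonal_tr : Q^T *m Q = 1%:M.
Proof. exact/mulmx1C/frame_orthogonal. Qed.

Lemma dotr_frame u v : dotr (u *m Q) (v *m Q) = dotr u v.
Proof.
have dE (x y : 'rV[R]_3) : dotr x y = (x *m y^T) 0 0.
  by rewrite mxE; apply: eq_bigr => k _; rewrite mxE.
by rewrite !dE trmx_mul mulmxA -(mulmxA u) frame_orthogonal mulmx1.
Qed.

Lemma frame_expansion x : x = dotr x a *: a + dotr x b *: b + dotr x c *: c.
Proof.
rewrite -[LHS]mulmx1 -frame_orthogonal_tr mulmxA mul_frameE.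
by congr (_ *: _ + _ *: _ + _ *: _); rewrite mxE; apply: eq_bigr => k _; rewrite !mxE.
Qed.

Lemma cross_bc : cross b c = a.
Proof.
have -> : cross b c = - cross b (cross b a).
  by apply: row3P; rewrite mxNE !crossE; ring.
rewrite cross_cross bb scale1r (_ : dotr b a = 0) ?scale0r ?sub0r ?opprK //.
by rewrite -ab !dotrE; ring.
Qed.

Lemma cross_ca : cross c a = b.
Proof.
have -> : cross c a = - cross a c by apply: row3P; rewrite mxNE !crossE; ring.
by rewrite cross_cross ab aa scale1r scale0r sub0r opprK.
Qed.

Lemma cross_frame u v : cross (u *m Q) (v *m Q) = cross u v *m Q.
Proof.
rewrite !mul_frameE cross_combination -/c cross_bc cross_ca !crossE.
by apply: row3P; rewrite !mxlinE; ring.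
Qed.

(** The determinant is the triple product of [a] with [cross b c], and the latter is [a] again. *)
Lemma det_frame : \det Q = 1.
Proof.
rewrite -aa -{2}cross_bc dotrE !crossE det_mx33 !mxE /=; ring.
Qed.

(* [Q - 1 = - Q (Q - 1)^T] has odd size, so its determinant is its own
   opposite. *)
Lemma frame_fixed_vector : exists2 w, dotr w w = 1 & w *m Q = w.
Proof.
have /det0P[w w0 /eqP wQ] : \det (Q - 1%:M) == 0.
  have : \det (Q - 1%:M) = - \det (Q - 1%:M).
    have {1}-> : Q - 1%:M = - (Q *m (Q - 1%:M)^T).
      by rewrite linearB /= trmx1 mulmxBr frame_orthogonal mulmx1 opprB.
    by rewrite -scaleN1r detZ det_mulmx det_frame mul1r det_tr; ring.
  by move=> /eqP; rewrite -subr_eq0 opprK -mulr2n mulrn_eq0.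
move: wQ; rewrite mulmxBr mulmx1 subr_eq0 => /eqP wQ.
have w_gt0 : 0 < dotr w w.
  have := sqr_ge0 (w 0 0); have := sqr_ge0 (w 0 1); have := sqr_ge0 (w 0 2).
  move=> h2 h1 h0; rewrite lt_neqAle dotrE !addr_ge0 -?expr2 // andbT eq_sym.
  apply: contraNN w0; rewrite !paddr_eq0 ?addr_ge0 // !sqrf_eq0.
  by move=> /andP[/andP[/eqP z0 /eqP z1] /eqP z2]; apply/eqP/row3P; rewrite mxE.
exists ((Num.sqrt (dotr w w))^-1 *: w); last by rewrite -scalemxAl wQ.
have -> k : dotr (k *: w) (k *: w) = k ^+ 2 * dotr w w.
  by rewrite !dotrE !mxZE; ring.
by rewrite exprVn sqr_sqrtr ?ltW // mulVf // gt_eqF.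
Qed.

End Frame.

(** If [w] lies on the third axis, the first axis will do; otherwise a quarter turn of the
    horizontal part of [w] is normalized. *)
Lemma unit_orthogonal (w : 'rV[R]_3) : exists2 v, dotr v v = 1 & dotr w v = 0.
Proof.
pose q := w 0 0 ^+ 2 + w 0 1 ^+ 2.
have [q0|q0] := eqVneq q 0.
  exists (row3 1 0 0); rewrite dotrE !row3E; first by ring.
  move: q0 => /eqP; rewrite paddr_eq0 ?sqr_ge0 // sqrf_eq0 => /andP[/eqP -> _].
  by ring.
exists ((Num.sqrt q)^-1 *: row3 (- w 0 1) (w 0 0) 0).
  have -> (k : R) (v : 'rV[R]_3) : dotr (k *: v) (k *: v) = k ^+ 2 * dotr v v.
    by rewrite !dotrE !mxZE; ring.
  rewrite exprVn sqr_sqrtr ?addr_ge0 ?sqr_ge0 // dotrE !row3E.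
  by rewrite (_ : _ + _ = q) ?mulVf // /q; ring.
by rewrite dotrE !mxZE !row3E; ring.
Qed.

(** The sine of [acos p] is nonnegative, so the opposite angle is taken when [q] is negative. *)
Lemma angle_exists (p q : R) : p ^+ 2 + q ^+ 2 = 1 ->
  exists theta, cos theta = p /\ sin theta = q.
Proof.
move=> pq; have p1 : -1 <= p <= 1.
  by rewrite -ler_norml -(@ler_sqr _ _ 1) ?nnegrE // expr1n real_normK ?num_real //
     -pq lerDl sqr_ge0.
have q2 : 1 - p ^+ 2 = q ^+ 2 by rewrite -pq; ring.
case: (leP 0 q) => q0.
  exists (acos p); rewrite acosK ?in_itv //= sin_acos // q2 sqrtr_sqr ger0_norm //.
exists (- acos p); rewrite cosN sinN acosK ?in_itv //= sin_acos // q2 sqrtr_sqr.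
by rewrite ltr0_norm // opprK.
Qed.

Lemma Jdir0 : Jd 0 = 0.
Proof. by rewrite /Jdir !mxE !scale0r !addr0. Qed.

Lemma JdirZ k v : Jd (k *: v) = k%:C *: Jd v.
Proof. by rewrite -[k *: v]addr0 Jdir_lin Jdir0 addr0. Qed.

Lemma JdirD u v : Jd (u + v) = Jd u + Jd v.
Proof. by rewrite -[u]scale1r Jdir_lin !scale1r. Qed.

Lemma Jdir_sum3 k l m u v w :
  Jd (k *: u + l *: v + m *: w) = k%:C *: Jd u + l%:C *: Jd v + m%:C *: Jd w.
Proof. by rewrite JdirD JdirD !JdirZ. Qed.

Lemma JdirN u : Jd (- u) = - Jd u.
Proof. by rewrite -scaleN1r JdirZ rmorphN1 scaleN1r. Qed.

Lemma rotation_unitary (T : mx) : rotation T -> T *m T^t* = 1%:M.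
Proof.
case=> theta [w [_ ->]]; apply: (mexp_unitary (exp_param_rotation theta)).
  exact: adj_Jdir.
by move=> x; exact: cis_normal.
Qed.

Lemma rotation_axis (theta : R) (w : 'rV[R]_3) :
  let T : mx := mexp (- ('i * theta%:C) *: Jdir w) in T *m Jd w = Jd w *m T.
Proof.
move=> T; have h : Jd w *m Jd w - Jd w *m Jd w = 0%:C *: Jd w.
  by rewrite subrr scale0r.
rewrite (mexp_intertwine (exp_param_rotation theta) (adj_Jdir d w) h).
by rewrite mulr0 oppr0 /cis cos0 sin0 mulr0 addr0 scale1r.
Qed.

Lemma intertwine_combination (C : numClosedFieldType) n (T B1 B2 : 'M[C]_n)
    (p q : C) :
  T *m (B1 + 'i *: B2) = (p - 'i * q) *: ((B1 + 'i *: B2) *m T) ->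
  T *m (B1 - 'i *: B2) = (p + 'i * q) *: ((B1 - 'i *: B2) *m T) ->
  T *m B1 = (p *: B1 + q *: B2) *m T.
Proof.
move=> h1 h2; apply: (@scalerI _ _ 2); first by rewrite pnatr_eq0.
have := congr2 +%R h1 h2; rewrite !mxexpand => h.
transitivity (T *m B1 + 'i *: (T *m B2) + (T *m B1 - 'i *: (T *m B2))).
  by clear; mxlin; ring.
rewrite h; transitivity (2 *: (p *: (B1 *m T) - ('i ^+ 2 * q) *: (B2 *m T))).
  by clear; mxlin; ring.
by rewrite sqrCi; clear; mxlin; ring.
Qed.

Lemma ladder_combination (C : numClosedFieldType) n (W V V' : 'M[C]_n) :
  W *m V - V *m W = 'i *: V' -> W *m V' - V' *m W = 'i *: - V ->
  W *m (V + 'i *: V') - (V + 'i *: V') *m W = V + 'i *: V' /\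
  W *m (V - 'i *: V') - (V - 'i *: V') *m W = - (V - 'i *: V').
Proof.
move=> /(canRL (subrK _)) h1 /(canRL (subrK _)) h2.
rewrite !mxexpand h1 h2; have ii := sqrCi C.
(* The identities hold only modulo ['i ^+ 2 = -1]. Naming the multiple of ['i ^+ 2 + 1] by which the
   two sides differ leaves polynomial identities for [ring]. *)
split; apply/eqP; rewrite -subr_eq0; apply/eqP;
  [transitivity ((- ('i ^+ 2 + 1)) *: V) | transitivity (('i ^+ 2 + 1) *: V)];
  by [rewrite ii addNr ?oppr0 scale0r | mxlin; ring].
Qed.

Lemma mulmx_sum3 (K : pzRingType) p n (A B D : 'M[K]_(p, n)) (M : 'M[K]_n) k l m :
  (k *: A + l *: B + m *: D) *m M = k *: (A *m M) + l *: (B *m M) + m *: (D *m M).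
Proof. by rewrite !mulmxDl -!scalemxAl. Qed.

Lemma intertwine_sum3 (C : numClosedFieldType) n (T A1 A2 A3 B1 B2 B3 : 'M[C]_n) k1 k2 k3 :
  T *m A1 = B1 *m T -> T *m A2 = B2 *m T -> T *m A3 = B3 *m T ->
  T *m (k1 *: A1 + k2 *: A2 + k3 *: A3) = (k1 *: B1 + k2 *: B2 + k3 *: B3) *m T.
Proof. by move=> h1 h2 h3; rewrite !mxexpand h1 h2 h3. Qed.

(* [J_v +- i J_(w x v)] raises or lowers the eigenvalues of [J_w] by [1]. *)
Lemma rotation_perp (theta : R) (w v : 'rV[R]_3) :
  let T : mx := mexp (- ('i * theta%:C) *: Jdir w) in
  dotr w w = 1 -> dotr w v = 0 ->
  T *m Jd v = Jd (cos theta *: v + sin theta *: cross w v) *m T.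
Proof.
move=> T w1 wv.
have wwv : cross w (cross w v) = - v by rewrite cross_cross wv w1 scale0r scale1r sub0r.
have h1 := comm_Jdir d w v; have h2 := comm_Jdir d w (cross w v).
rewrite wwv JdirN in h2.
rewrite JdirD !JdirZ; apply: intertwine_combination.
  have h : Jd w *m (Jd v + 'i *: Jd (cross w v)) - (Jd v + 'i *: Jd (cross w v)) *m Jd w
    = 1%:C *: (Jd v + 'i *: Jd (cross w v)).
    by rewrite scale1r; exact: (ladder_combination h1 h2).1.
  rewrite (mexp_intertwine (exp_param_rotation theta) (adj_Jdir d w) h).
  by rewrite mulr1 /cis cosN sinN rmorphN /= mulrN.
have h : Jd w *m (Jd v - 'i *: Jd (cross w v)) - (Jd v - 'i *: Jd (cross w v)) *m Jd w
    = (-1)%:C *: (Jd v - 'i *: Jd (cross w v)).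
  by rewrite rmorphN1 scaleN1r; exact: (ladder_combination h1 h2).2.
rewrite (mexp_intertwine (exp_param_rotation theta) (adj_Jdir d w) h).
by rewrite mulrN1 opprK.
Qed.

(** Euler's rotation theorem: [Q] fixes a unit vector [w], hence turns the plane orthogonal to it by
    some angle [theta]. The exponential with this axis and angle implements [Q] on [w], [v] and
    [cross w v], and by linearity everywhere. *)
Lemma frame_rotation (a b : 'rV[R]_3) :
  dotr a a = 1 -> dotr b b = 1 -> dotr a b = 0 ->
  exists T : mx, rotation T /\
    forall x, T *m Jd x = Jd (x *m frame a b (cross a b)) *m T.
Proof.
move=> aa bb ab; set Q := frame _ _ _.
have [w w1] := frame_fixed_vector aa bb ab; rewrite -/Q => wQ.
have [v v1 wv] := unit_orthogonal w.
have vw : dotr v w = 0 by rewrite -wv !dotrE; ring.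
pose p := dotr (v *m Q) v; pose q := dotr (v *m Q) (cross w v).
have vQ : v *m Q = p *: v + q *: cross w v.
  (* Since [Q] fixes [w] and preserves scalar products, the image of [v] has no component along
     [w]. *)
  rewrite {1}(frame_expansion w1 v1 wv (v *m Q)) -{1}wQ dotr_frame //.
  by rewrite vw scale0r add0r.
have [theta [cosE sinE]] : exists theta, cos theta = p /\ sin theta = q.
  apply: angle_exists; rewrite -v1 -[in RHS](dotr_frame aa bb ab) -/Q vQ.
  have -> : dotr (p *: v + q *: cross w v) (p *: v + q *: cross w v) =
    p ^+ 2 * dotr v v + p * q * dotr v (cross w v) *+ 2 +
    q ^+ 2 * dotr (cross w v) (cross w v).
    by rewrite !dotrE !mxlinE; ring.
  by rewrite dotr_crossr dotr_cross_cross v1 w1 wv; ring.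
have wwv : cross w (cross w v) = - v by rewrite cross_cross wv w1 scale0r scale1r sub0r.
have v'Q : cross w v *m Q = p *: cross w v + q *: cross w (cross w v).
  rewrite -cross_frame // wQ vQ.
  by apply: row3P; rewrite ?crossE ?mxlinE ?crossE; ring.
pose T : mx := mexp (- ('i * theta%:C) *: Jdir w).
exists T; split; first by exists theta, w.
move=> x; have [k [l [m xE]]] : exists k l m, x = k *: w + l *: v + m *: cross w v.
  by do 3 eexists; exact: frame_expansion.
have -> : x *m Q = k *: w + l *: (p *: v + q *: cross w v) +
    m *: (p *: cross w v + q *: cross w (cross w v)).
  by rewrite xE mulmx_sum3 wQ vQ v'Q.
rewrite xE !Jdir_sum3; apply: intertwine_sum3.
- exact: rotation_axis.
- by rewrite -cosE -sinE; exact: rotation_perp.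
- by rewrite -cosE -sinE; apply: rotation_perp => //; exact: dotr_crossl.
Qed.

End Rotations.

(** * Trace inequalities and the equality case *)

Section TraceInequalities.
Variables (C : numClosedFieldType) (n : nat).
Implicit Types A B X Y Z r rho : 'M[C]_n.

Lemma mxtrace_adj A : \tr (A^t*) = (\tr A)^*.
Proof. by rewrite trace_map_mx mxtrace_tr. Qed.

Lemma trace_adj_mulE A : \tr (A^t* *m A) = \sum_i \sum_k `|A k i| ^+ 2.
Proof.
apply: eq_bigr => i _; rewrite mxE; apply: eq_bigr => k _.
by rewrite !mxE normCK mulrC.
Qed.

Lemma trace_adj_mul_ge0 A : 0 <= \tr (A^t* *m A).
Proof.
rewrite trace_adj_mulE; apply: sumr_ge0 => i _; apply: sumr_ge0 => k _.
by rewrite exprn_ge0.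
Qed.

Lemma trace_adj_mul_eq0 A : \tr (A^t* *m A) = 0 -> A = 0.
Proof.
rewrite trace_adj_mulE => /psumr_eq0P h; apply/matrixP => k i; rewrite mxE.
have /psumr_eq0P h2 := h (fun i _ => sumr_ge0 _ (fun k _ => exprn_ge0 2 (normr_ge0 (A k i)))) i isT.
have /eqP := h2 (fun k _ => exprn_ge0 2 (normr_ge0 (A k i))) k isT.
by rewrite expf_eq0 /= normr_eq0 => /eqP.
Qed.

Lemma trace_mul_real A B : A^t* = A -> B^t* = B -> \tr (A *m B) \is Num.real.
Proof.
by move=> hA hB; rewrite CrealE -mxtrace_adj adjmxM hA hB mxtrace_mulC.
Qed.

Lemma trace_sqr_ge0 A : A^t* = A -> 0 <= \tr (A *m A).
Proof. by move=> hA; rewrite -{1}hA trace_adj_mul_ge0. Qed.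

Lemma trace_sqr_eq0 A : A^t* = A -> \tr (A *m A) = 0 -> A = 0.
Proof. by move=> hA; rewrite -{1}hA => /trace_adj_mul_eq0. Qed.

Lemma trace_lincomb_sqr A B p c : \tr ((p *: B - c *: A) *m (p *: B - c *: A)) =
  p ^+ 2 * \tr (B *m B) - p * c * \tr (A *m B) *+ 2 + c ^+ 2 * \tr (A *m A).
Proof.
rewrite !mxexpand !(mxtraceD, mxtraceZ, raddfN) /= !mxtraceZ.
by rewrite (mxtrace_mulC B A); ring.
Qed.

(** For [p = \tr (A *m A)], [c = \tr (A *m B)] and [q = \tr (B *m B)], the Hermitian matrix
    [p B - c A] has squared norm [p (p q - c^2)]. *)
Lemma trace_CauchySchwarz A B : A^t* = A -> B^t* = B ->
  \tr (A *m B) ^+ 2 <= \tr (A *m A) * \tr (B *m B).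
Proof.
move=> hA hB; have p0 := trace_sqr_ge0 hA.
have [pE|pN] := eqVneq (\tr (A *m A)) 0.
  by rewrite pE mul0r (trace_sqr_eq0 hA pE) mul0mx raddf0 expr0n.
have cR : (\tr (A *m B))^* = \tr (A *m B) by apply/CrealP/trace_mul_real.
have pR : (\tr (A *m A))^* = \tr (A *m A) by apply/CrealP/ger0_real.
have : 0 <= \tr (A *m A) * (\tr (A *m A) * \tr (B *m B) - \tr (A *m B) ^+ 2).
  have := trace_lincomb_sqr A B (\tr (A *m A)) (\tr (A *m B)).
  set W := _ - _ => E; have hW : W^t* = W.
    by rewrite adjmxD adjmxN !adjmxZ hA hB cR pR.
  have := trace_sqr_ge0 hW; rewrite E; move: (\tr _) (\tr _) (\tr _) => p c q.
  by rewrite [X in 0 <= X -> _](_ : _ = q * (q * c - p ^+ 2)) //; ring.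
by rewrite pmulr_rge0 ?subr_ge0 // lt_neqAle eq_sym pN.
Qed.

(** In the case of equality the squared norm of [p B - c A] vanishes; a nonzero [\tr (A *m B)]
    excludes [A = 0] and allows the division by [p]. *)
Lemma trace_CauchySchwarz_eq A B : A^t* = A -> B^t* = B ->
  \tr (A *m B) != 0 -> \tr (A *m B) ^+ 2 = \tr (A *m A) * \tr (B *m B) ->
  exists2 k, k \is Num.real & B = k *: A.
Proof.
move=> hA hB cN E; have pN : \tr (A *m A) != 0.
  apply: contraNneq cN => pE.
  by rewrite (trace_sqr_eq0 hA pE) mul0mx raddf0.
have cR := trace_mul_real hA hB; have pR := ger0_real (trace_sqr_ge0 hA).
exists (\tr (A *m B) / \tr (A *m A)); first by rewrite realM ?realV.
apply: (scalerI pN); rewrite scalerA mulrCA mulfV // mulr1.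
apply/eqP; rewrite -subr_eq0; apply/eqP; apply: trace_sqr_eq0.
  by rewrite adjmxD adjmxN !adjmxZ hA hB (CrealP cR) (CrealP pR).
rewrite trace_lincomb_sqr; move: E.
move: (\tr (A *m A)) (\tr (A *m B)) (\tr (B *m B)) => p c q E.
transitivity (p * (p * q - c ^+ 2)); first ring.
by rewrite E subrr mulr0.
Qed.

Lemma psd_adj r : psdmx r -> r^t* = r.
Proof. by move=> [/hermsymmxP]. Qed.

(* [tr (X r X) = - tr (r X X)] vanishes, and it is the squared norm of
   [sqrtmx r *m X]. *)
Lemma psd_anticommutator_eq0 r X : psdmx r -> X^t* = X ->
  r *m X + X *m r = 0 -> r *m X = 0.
Proof.
move=> pr hX E; have hs := psd_adj (sqrtmx_psd pr); have ss := sqrtmxK pr.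
set s := sqrtmx r in hs ss.
have E' : r *m X = - (X *m r) by apply/eqP; rewrite -addr_eq0 E.
have t0 : \tr (X *m r *m X) = 0.
  have : \tr (X *m r *m X) = - \tr (X *m r *m X).
    by rewrite -{1}mulmxA E' mulmxN raddfN /= mxtrace_mulC.
  by move=> /eqP; rewrite -addr_eq0 -mulr2n mulrn_eq0 /= => /eqP.
have : s *m X = 0.
  by apply: trace_adj_mul_eq0; rewrite adjmxM hX hs mulmxA -(mulmxA X) ss.
by rewrite -ss -mulmxA => ->; rewrite mulmx0.
Qed.

(** The trace of [r] is the squared norm of its square root. *)
Lemma psd_trace_neq0 r : psdmx r -> r != 0 -> \tr r != 0.
Proof.
move=> pr; apply: contra_neq => t0; rewrite -(sqrtmxK pr).
have hs := psd_adj (sqrtmx_psd pr).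
by rewrite (@trace_sqr_eq0 (sqrtmx r)) ?mulmx0 // sqrtmxK.
Qed.

End TraceInequalities.

(** * Algebraic consequences of the two equations *)

Section EqualityEquations.
Variables (C : numClosedFieldType) (n : nat) (r X Y Z : 'M[C]_n) (s t : C).

(* With [P = Y + i s X], [Q = Y - i s X] and [P' = X + i t Y], [Q' = X - i t Y]
   the equations read [r P = - Q r] and [r P' = - Q' r]; hence
   [r [P, P'] = [Q, Q'] r], and both commutators are [- i (1 + s t) Z]. *)
Lemma equations_commute : X *m Y - Y *m X = 'i *: Z ->
  ('i * s) *: (r *m X - X *m r) + (r *m Y + Y *m r) = 0 ->
  ('i * t) *: (r *m Y - Y *m r) + (r *m X + X *m r) = 0 ->
  (1 + s * t) *: (r *m Z - Z *m r) = 0.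
Proof.
move=> xy e1 e2.
have {e1} f1 : r *m (Y + ('i * s) *: X) = - ((Y - ('i * s) *: X) *m r).
  by apply/eqP; rewrite -subr_eq0 opprK -e1 !mxexpand; apply/eqP; mxlin; ring.
have {e2} f2 : r *m (X + ('i * t) *: Y) = - ((X - ('i * t) *: Y) *m r).
  by apply/eqP; rewrite -subr_eq0 opprK -e2 !mxexpand; apply/eqP; mxlin; ring.
have comm (p q : C) : (Y + p *: X) *m (X + q *: Y) - (X + q *: Y) *m (Y + p *: X) =
    (p * q - 1) *: ('i *: Z) by rewrite -xy !mxexpand; mxlin; ring.
have g : r *m ((Y + ('i * s) *: X) *m (X + ('i * t) *: Y) -
               (X + ('i * t) *: Y) *m (Y + ('i * s) *: X)) =
    ((Y - ('i * s) *: X) *m (X - ('i * t) *: Y) -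
     (X - ('i * t) *: Y) *m (Y - ('i * s) *: X)) *m r.
  rewrite mulmxBr mulmxBl !mulmxA f1 f2 !mulNmx -!mulmxA f1 f2 !mulmxN !opprK.
  by rewrite !mulmxA.
move: g; rewrite comm -(scaleNr _ X) -(scaleNr _ Y) comm !mxexpand => g.
have ii : ('i * s) * ('i * t) = - (s * t) by rewrite mulrACA -expr2 sqrCi mulN1r.
have ii' : - ('i * s) * - ('i * t) = - (s * t) by rewrite mulrNN.
move: g; rewrite ii ii' !scalerA -opprD mulNr -!(mulrC 'i) => /eqP.
rewrite -subr_eq0 => /eqP g.
apply: (@scalerI _ _ (- 'i)); first by rewrite oppr_eq0 neq0Ci.
by rewrite scaler0 -g; mxlin; ring.
Qed.

(** Multiplying the second equation by ['i * s] gives its commutator the coefficient [- s t = 1];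
    subtracting it from the first one cancels all terms with [r] on the left. *)
Lemma equations_squeezed : s * t = -1 ->
  ('i * s) *: (r *m X - X *m r) + (r *m Y + Y *m r) = 0 ->
  ('i * t) *: (r *m Y - Y *m r) + (r *m X + X *m r) = 0 ->
  (Y - ('i * s) *: X) *m r = 0.
Proof.
move=> st e1 e2; apply: (@scalerI _ _ 2); first by rewrite pnatr_eq0.
have e2' : (r *m Y - Y *m r) + ('i * s) *: (r *m X + X *m r) = 0.
  have := congr1 (fun M => ('i * s) *: M) e2.
  by rewrite scaler0 scalerDr scalerA mulrACA -expr2 sqrCi st mulrNN mul1r scale1r.
rewrite scaler0 -[RHS](subrr 0) -{1}e1 -e2' !mxexpand; mxlin; ring.
Qed.

(** These are the second equation plus and minus ['i] times the first. *)
Lemma equations_ladder :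
  ('i * s) *: (r *m X - X *m r) + (r *m Y + Y *m r) = 0 ->
  ('i * - s) *: (r *m Y - Y *m r) + (r *m X + X *m r) = 0 ->
  (1 + s) *: ((X + 'i *: Y) *m r) = (s - 1) *: (r *m (X + 'i *: Y)) /\
  (1 + s) *: (r *m (X - 'i *: Y)) = (s - 1) *: ((X - 'i *: Y) *m r).
Proof.
move=> e1 e2; split; apply/eqP; rewrite -subr_eq0; apply/eqP.
  transitivity (('i * - s) *: (r *m Y - Y *m r) + (r *m X + X *m r) +
    'i *: (('i * s) *: (r *m X - X *m r) + (r *m Y + Y *m r)) +
    (- ('i ^+ 2 + 1) * s) *: (r *m X - X *m r)).
    by rewrite !mxexpand; mxlin; ring.
  by rewrite e1 e2 sqrCi addNr oppr0 mul0r scale0r scaler0 !addr0.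
transitivity (('i * - s) *: (r *m Y - Y *m r) + (r *m X + X *m r) -
    'i *: (('i * s) *: (r *m X - X *m r) + (r *m Y + Y *m r)) +
    (('i ^+ 2 + 1) * s) *: (r *m X - X *m r)).
  by rewrite !mxexpand; mxlin; ring.
by rewrite e1 e2 sqrCi addNr mul0r scale0r scaler0 oppr0 !addr0.
Qed.

End EqualityEquations.

(** * The uncertainty relation as a pair of Cauchy-Schwarz inequalities *)

Lemma sqrtC_product_eq (C : numClosedFieldType) (a b p q T : C) :
  0 <= T -> 0 <= q -> 0 <= b -> 0 <= p -> 0 <= a ->
  sqrtC (2^-1 * a * (2^-1 * b)) * sqrtC (2^-1 * p * (2^-1 * q)) = 4^-1 * T <->
  a * q * (p * b) = T ^+ 2.
Proof.
move=> T0 q0 b0 p0 a0; have h0 : 0 <= 2^-1 :> C by rewrite invr_ge0 ler0n.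
have U0 : 0 <= 2^-1 * a * (2^-1 * b) by rewrite !mulr_ge0.
have V0 : 0 <= 2^-1 * p * (2^-1 * q) by rewrite !mulr_ge0.
have sqrE : (sqrtC (2^-1 * a * (2^-1 * b)) * sqrtC (2^-1 * p * (2^-1 * q))) ^+ 2 =
    (4^-1) ^+ 2 * (a * q * (p * b)) by rewrite exprMn !sqrtCK; field.
have LE : (sqrtC (2^-1 * a * (2^-1 * b)) * sqrtC (2^-1 * p * (2^-1 * q)) == 4^-1 * T) =
    ((4^-1) ^+ 2 * (a * q * (p * b)) == (4^-1 * T) ^+ 2).
  by rewrite -sqrE eqrXn2 ?mulr_ge0 ?sqrtC_ge0 ?invr_ge0 ?ler0n.
have N4 : (4^-1 : C) ^+ 2 != 0 by rewrite expf_neq0 // invr_eq0 pnatr_eq0.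
split=> [/eqP|E]; last by apply/eqP; rewrite LE exprMn E.
by rewrite LE exprMn => /eqP /(mulfI N4).
Qed.

Lemma eq_of_mul_eq_sqr (C : numDomainType) (T p q : C) :
  0 < T -> T <= p -> T <= q -> p * q = T ^+ 2 -> T = p /\ T = q.
Proof.
move=> T0 Tp Tq E; have p0 := lt_le_trans T0 Tp.
suff Tp' : T = p by split=> //; apply: (mulfI (lt0r_neq0 p0)); rewrite E -{1}Tp'.
apply/eqP; rewrite eq_le Tp /= -(ler_pM2r T0) -expr2 -E ler_pM2l //.
Qed.

Lemma trace_scale_sqr (C : comPzRingType) n (k : C) (M : 'M[C]_n) :
  \tr ((k *: M) *m (k *: M)) = k ^+ 2 * \tr (M *m M).
Proof. by rewrite -scalemxAl -scalemxAr !mxtraceZ mulrA. Qed.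

Section UncertaintyEquality.
Variables (C : numClosedFieldType) (n : nat).
Implicit Types X Y Z r rho : 'M[C]_n.

(* Since [Z] commutes with [r], applying [[Z, -]] to one equation turns it into
   a relation with the terms of the other one. *)
Lemma equations_diagonal r X Y Z (s t x y : C) : \tr r != 0 ->
  Z *m X - X *m Z = 'i *: Y -> Z *m Y - Y *m Z = - 'i *: X ->
  r *m Z = Z *m r ->
  ('i * s) *: (r *m X - X *m r) + (r *m Y + Y *m r) = (2 * y) *: r ->
  ('i * t) *: (r *m Y - Y *m r) + (r *m X + X *m r) = (2 * x) *: r ->
  [/\ x = 0, y = 0, (s + t) *: (r *m X - X *m r) = 0 &
      (s + t) *: (r *m Y - Y *m r) = 0].
Proof.
move=> trN zx zy rz e1 e2.
have adl U V k : Z *m U - U *m Z = k *: V ->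
    Z *m (r *m U) - (r *m U) *m Z = k *: (r *m V).
  by move=> zu; rewrite mulmxA -rz -!mulmxA -mulmxBr zu -scalemxAr.
have adr U V k : Z *m U - U *m Z = k *: V ->
    Z *m (U *m r) - (U *m r) *m Z = k *: (V *m r).
  by move=> zu; rewrite -(mulmxA U) rz !mulmxA -mulmxBl zu -scalemxAl.
have adD p U1 U2 U3 U4 : Z *m (p *: (U1 - U2) + (U3 + U4)) -
    (p *: (U1 - U2) + (U3 + U4)) *m Z = p *: ((Z *m U1 - U1 *m Z) -
    (Z *m U2 - U2 *m Z)) + ((Z *m U3 - U3 *m Z) + (Z *m U4 - U4 *m Z)).
  by rewrite !mxexpand; mxlin; ring.
have ad0 (k : C) : Z *m (k *: r) - (k *: r) *m Z = 0.
  by rewrite -scalemxAr -scalemxAl rz subrr.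
have ii := sqrCi C.
have f1 : ('i * s) *: (r *m Y - Y *m r) = r *m X + X *m r.
  have := congr1 (fun M => Z *m M - M *m Z) e1.
  rewrite ad0 adD !(adl _ _ _ zx, adr _ _ _ zx, adl _ _ _ zy, adr _ _ _ zy) => h.
  apply/eqP; rewrite -subr_eq0; apply/eqP; rewrite -[RHS](scaler0 _ (- 'i)) -h.
  apply/eqP; rewrite -subr_eq0; apply/eqP.
  transitivity (('i ^+ 2 + 1) *: (('i * s) *: (r *m Y - Y *m r) - (r *m X + X *m r))).
    by clear; mxlin; ring.
  by rewrite ii addNr scale0r.
have f2 : ('i * t) *: (r *m X - X *m r) = r *m Y + Y *m r.
  have := congr1 (fun M => Z *m M - M *m Z) e2.
  rewrite ad0 adD !(adl _ _ _ zx, adr _ _ _ zx, adl _ _ _ zy, adr _ _ _ zy) => h.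
  apply/eqP; rewrite -subr_eq0; apply/eqP; rewrite -[RHS](scaler0 _ 'i) -h.
  apply/eqP; rewrite -subr_eq0; apply/eqP.
  transitivity (('i ^+ 2 + 1) *: (('i * t) *: (r *m X - X *m r) - (r *m Y + Y *m r))).
    by clear; mxlin; ring.
  by rewrite ii addNr scale0r.
have tr0 (k p : C) U : k *: (r *m U - U *m r) = (2 * p) *: r -> p = 0.
  move=> /(congr1 (@mxtrace _ _)); rewrite !mxtraceZ raddfB /= (mxtrace_mulC r U).
  rewrite subrr mulr0 => /esym/eqP; rewrite !mulf_eq0 (negPf trN) orbF.
  by rewrite pnatr_eq0 /= => /eqP.
have g1 : ('i * (s + t)) *: (r *m X - X *m r) = (2 * y) *: r.
  by rewrite -e1 -f2 mulrDr scalerDl.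
have g2 : ('i * (s + t)) *: (r *m Y - Y *m r) = (2 * x) *: r.
  by rewrite -e2 -f1 mulrDr scalerDl addrC.
have x0 := tr0 _ _ _ g2; have y0 := tr0 _ _ _ g1.
move: g1 g2; rewrite x0 y0 mulr0 scale0r -!scalerA => g1 g2.
by split=> //; apply: (scalerI (neq0Ci C)); rewrite scaler0.
Qed.

(** By cyclicity of the trace; this links the two expressions of the Wigner-Yanase skew
    information. *)
Lemma trace_commutator_sqr r X :
  \tr (('i *: commutator_mx r X) *m ('i *: commutator_mx r X)) =
  2 * (\tr (r *m r *m (X *m X)) - \tr (r *m X *m r *m X)).
Proof.
rewrite /commutator_mx -scalemxAl -scalemxAr !mxtraceZ mulrA -expr2 sqrCi.
rewrite mulmxBr !mulmxBl !mulmxA !raddfB /=.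
have -> : \tr (r *m X *m X *m r) = \tr (r *m r *m X *m X).
  by rewrite mxtrace_mulC !mulmxA.
have -> : \tr (X *m r *m r *m X) = \tr (r *m r *m X *m X).
  by rewrite mxtrace_mulC !mulmxA mxtrace_mulC !mulmxA mxtrace_mulC !mulmxA.
have -> : \tr (X *m r *m X *m r) = \tr (r *m X *m r *m X).
  by rewrite mxtrace_mulC !mulmxA.
by ring.
Qed.

(** By cyclicity the commutator is orthogonal to [r], so the shift by [y] is invisible, and the two
    terms of type [r X r Y] cancel. *)
Lemma trace_commutator_mixed r X Y y :
  \tr (('i *: commutator_mx r X) *m (r *m Y + Y *m r - y *: r)) =
  'i * \tr (r *m r *m (X *m Y - Y *m X)).
Proof.
rewrite /commutator_mx -scalemxAl mxtraceZ; congr (_ * _).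
rewrite mulmxBr -scalemxAr raddfB /= mxtraceZ.
have -> : \tr ((r *m X - X *m r) *m r) = 0.
  by rewrite mulmxBl raddfB /= (mxtrace_mulC (X *m r)) mulmxA subrr.
rewrite mulr0 subr0 !mxexpand !mulmxA !(raddfD, raddfN) /=.
have -> : \tr (r *m X *m Y *m r) = \tr (r *m r *m X *m Y).
  by rewrite mxtrace_mulC !mulmxA.
have -> : \tr (X *m r *m r *m Y) = \tr (r *m r *m Y *m X).
  by rewrite -!mulmxA mxtrace_mulC !mulmxA.
have -> : \tr (X *m r *m Y *m r) = \tr (r *m X *m r *m Y).
  by rewrite mxtrace_mulC !mulmxA.
by ring.
Qed.

Variable rho : 'M[C]_n.
Hypothesis rho_density : density rho.
Local Notation r := (sqrtmx rho).

Let rho_psd : psdmx rho. Proof. by case: rho_density. Qed.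
Let rr : r *m r = rho. Proof. exact: sqrtmxK. Qed.
Let r_psd : psdmx r. Proof. exact: sqrtmx_psd. Qed.
Let r_adj : r^t* = r. Proof. exact: psd_adj. Qed.

Lemma sqrt_density_neq0 : r != 0.
Proof.
apply/eqP => r0; have [_] := rho_density; rewrite -rr r0 mul0mx raddf0.
by move/eqP; rewrite eq_sym oner_eq0.
Qed.

Lemma sqrt_density_trace_neq0 : \tr r != 0.
Proof. exact: (psd_trace_neq0 r_psd sqrt_density_neq0). Qed.

Lemma density_trace_real X : X^t* = X -> \tr (rho *m X) \is Num.real.
Proof. by apply: trace_mul_real; exact: psd_adj. Qed.

Lemma adj_commutator X : X^t* = X ->
  ('i *: commutator_mx r X)^t* = 'i *: commutator_mx r X.
Proof.
move=> hX; rewrite /commutator_mx; move: r_adj; move: r => q hq.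
by rewrite adjmxZ adjmxD adjmxN !adjmxM hX hq conjCi scaleNr -scalerN opprB.
Qed.

Lemma adj_centered X : X^t* = X -> (centered rho X)^t* = centered rho X.
Proof.
move=> hX; rewrite /centered adjmxD adjmxN hX; congr (_ - _).
rewrite tr_scalar_mx map_scalar_mx; congr (_%:M).
exact/CrealP/density_trace_real.
Qed.

Lemma adj_anticommutator X : X^t* = X ->
  (anticommutator_mx r (centered rho X))^t* = anticommutator_mx r (centered rho X).
Proof.
move=> hX; have hc := adj_centered hX.
rewrite /anticommutator_mx; move: r_adj hc; move: r (centered rho X) => q Y hq hY.
by rewrite adjmxD !adjmxM hY hq addrC.
Qed.

Lemma anticommutator_centered X : anticommutator_mx r (centered rho X) =
  r *m X + X *m r - (2 * \tr (rho *m X)) *: r.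
Proof.
rewrite /anticommutator_mx /centered; move: (\tr _) => x.
rewrite mulmxBr mulmxBl mul_scalar_mx mul_mx_scalar.
by mxlin; ring.
Qed.

Lemma skew_infoE X : skew_info rho X =
  2^-1 * \tr (('i *: commutator_mx r X) *m ('i *: commutator_mx r X)).
Proof. by rewrite trace_commutator_sqr rr mulrA mulVf ?mul1r // pnatr_eq0. Qed.

Lemma trace_commutator_anticommutator X Y :
  \tr (('i *: commutator_mx r X) *m anticommutator_mx r (centered rho Y)) =
  'i * \tr (rho *m (X *m Y - Y *m X)).
Proof. by rewrite anticommutator_centered trace_commutator_mixed rr. Qed.

Section Pair.
Variables X Y Z : 'M[C]_n.
Hypotheses (hX : X^t* = X) (hY : Y^t* = Y) (hZ : Z^t* = Z).
Hypothesis xy : X *m Y - Y *m X = 'i *: Z.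
Let A U := 'i *: commutator_mx r U.
Let B U := anticommutator_mx r (centered rho U).
Let tau := \tr (rho *m Z).

Let AXBY : \tr (A X *m B Y) = - tau.
Proof.
rewrite trace_commutator_anticommutator xy -scalemxAr mxtraceZ mulrA -expr2 sqrCi.
by rewrite mulN1r.
Qed.

Let AYBX : \tr (A Y *m B X) = tau.
Proof.
rewrite trace_commutator_anticommutator.
have -> : Y *m X - X *m Y = - ('i *: Z) by rewrite -xy opprB.
rewrite mulmxN -scalemxAr raddfN /= mxtraceZ.
by rewrite mulrN mulrA -expr2 sqrCi mulN1r opprK.
Qed.

Let tau_real : tau \is Num.real. Proof. exact: density_trace_real. Qed.

(** Besides removing the square roots, this regroups the factors: each uncertainty pairs the
    commutator and the anticommutator of one observable, whereas Cauchy-Schwarz pairs the commutator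
    of one observable with the anticommutator of the other. *)
Lemma uncertainty_product_eq :
  uncertainty rho X * uncertainty rho Y = 4^-1 * `|tau| ^+ 2 <->
  (\tr (A X *m A X) * \tr (B Y *m B Y)) * (\tr (A Y *m A Y) * \tr (B X *m B X)) =
  (tau ^+ 2) ^+ 2.
Proof.
have hA U : U^t* = U -> 0 <= \tr (A U *m A U).
  by move=> hU; apply: trace_sqr_ge0; exact: adj_commutator.
have hB U : U^t* = U -> 0 <= \tr (B U *m B U).
  by move=> hU; apply: trace_sqr_ge0; exact: adj_anticommutator.
rewrite /uncertainty !skew_infoE /skew_coinfo -/(A X) -/(A Y) -/(B X) -/(B Y).
rewrite real_normK //.
have := hA _ hX; have := hA _ hY; have := hB _ hX; have := hB _ hY.
have : 0 <= tau ^+ 2 by rewrite real_exprn_even_ge0.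
move: (\tr _) (\tr _) (\tr _) (\tr _) (tau ^+ 2) => a p b q T *.
exact: sqrtC_product_eq.
Qed.

Let neg_scale U (k : C) W : W = - k *: (A U) ->
  ('i * k) *: commutator_mx r U + W = 0.
Proof. by move=> ->; rewrite scalerA addrC -scalerDl mulNr (mulrC k) addNr scale0r. Qed.

Let scale_neg U (k : C) W : ('i * k) *: commutator_mx r U + W = 0 ->
  W = - k *: (A U).
Proof.
by move=> /eqP; rewrite addrC addr_eq0 => /eqP ->; rewrite scalerA mulNr (mulrC k) scaleNr.
Qed.

Lemma equations_of_equality : tau != 0 ->
  uncertainty rho X * uncertainty rho Y = 4^-1 * `|tau| ^+ 2 ->
  exists s t, [/\ s \is Num.real, t \is Num.real,
    ('i * s) *: commutator_mx r X + B Y = 0 & ('i * t) *: commutator_mx r Y + B X = 0].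
Proof.
move=> tauN /uncertainty_product_eq E.
have hAX := adj_commutator hX; have hAY := adj_commutator hY.
have hBX := adj_anticommutator hX; have hBY := adj_anticommutator hY.
have T0 : 0 < tau ^+ 2 by rewrite real_exprn_even_gt0.
have le1 := trace_CauchySchwarz hAX hBY; have le2 := trace_CauchySchwarz hAY hBX.
rewrite -/(A X) -/(A Y) -/(B X) -/(B Y) AXBY AYBX sqrrN in le1 le2.
have [E1 E2] := eq_of_mul_eq_sqr T0 le1 le2 E.
have AXBY_neq0 : \tr (A X *m B Y) != 0 by rewrite AXBY oppr_eq0.
have AYBX_neq0 : \tr (A Y *m B X) != 0 by rewrite AYBX.
have [k kR kE] : exists2 k, k \is Num.real & B Y = k *: A X.
  by apply: trace_CauchySchwarz_eq => //; rewrite AXBY sqrrN.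
have [l lR lE] : exists2 l, l \is Num.real & B X = l *: A Y.
  by apply: trace_CauchySchwarz_eq => //; rewrite AYBX.
exists (- k), (- l); split; rewrite ?rpredN //; apply: neg_scale; by rewrite opprK.
Qed.

Variables s t : C.
Hypotheses (eX : ('i * s) *: commutator_mx r X + B Y = 0)
  (eY : ('i * t) *: commutator_mx r Y + B X = 0).

(** The first equation says [B Y = - s A X]; taking the trace against [A X] brings in [AXBY]. *)
Let tauX : s * \tr (A X *m A X) = tau.
Proof.
by rewrite -[RHS]opprK -AXBY (scale_neg eX) -(scalemxAr (- s)) mxtraceZ mulNr opprK.
Qed.

Let tauY : t * \tr (A Y *m A Y) = - tau.
Proof.
by rewrite -AYBX (scale_neg eY) -(scalemxAr (- t)) mxtraceZ mulNr opprK.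
Qed.

Lemma equality_of_equations :
  uncertainty rho X * uncertainty rho Y = 4^-1 * `|tau| ^+ 2.
Proof.
apply/uncertainty_product_eq; rewrite (scale_neg eX) (scale_neg eY).
rewrite (trace_scale_sqr (- s)) (trace_scale_sqr (- t)).
transitivity ((s * \tr (A X *m A X)) ^+ 2 * (t * \tr (A Y *m A Y)) ^+ 2); first by ring.
by rewrite tauX tauY; ring.
Qed.

(** By [tauX] and [tauY], each parameter or the commutator that it multiplies is zero. Both
    anticommutators then vanish, and [psd_anticommutator_eq0] applies. *)
Lemma kernel_of_equations : tau = 0 ->
  r *m centered rho X = 0 /\ r *m centered rho Y = 0.
Proof.
move=> tau0; have hc U : U^t* = U -> (centered rho U)^t* = centered rho U.
  exact: adj_centered.
split; (apply: psd_anticommutator_eq0 => //; first exact: hc).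
  rewrite -[LHS]/(B X) (scale_neg eY); move/eqP: tauY; rewrite tau0 oppr0 mulf_eq0.
  move=> /orP[/eqP ->|/eqP /trace_sqr_eq0 ->]; rewrite ?oppr0 ?scale0r ?scaler0 //.
  exact: adj_commutator.
rewrite -[LHS]/(B Y) (scale_neg eX); move/eqP: tauX; rewrite tau0 mulf_eq0.
move=> /orP[/eqP ->|/eqP /trace_sqr_eq0 ->]; rewrite ?oppr0 ?scale0r ?scaler0 //.
exact: adj_commutator.
Qed.

End Pair.
End UncertaintyEquality.

(** * Normal forms of the states *)

Section SpinStates.
Variables (R : realType) (d : nat).
Local Notation mx := ('M[R[i]]_d.+1).
Local Notation Jd := (@Jdir R d).
Local Notation Jx := (@Jx R d).
Local Notation Jy := (@Jy R d).
Local Notation Jz := (@Jz R d).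
Local Notation Jplus := (@Jplus R d).
Local Notation Jminus := (@Jminus R d).

Lemma ladderC_neq0 k : (0 < k <= d)%N -> (ladder R d k)%:C != 0 :> R[i].
Proof. by move=> kd; rewrite fmorph_eq0 ladder_neq0. Qed.

(** Only the highest weight, index [0], survives in the kernel: row [k - 1] of the product is row
    [k] of [M] times a nonzero ladder coefficient. *)
Lemma Jplus_kernel n (M : 'M[R[i]]_(d.+1, n)) (k : 'I_d.+1) b :
  Jplus *m M = 0 -> (0 < k)%N -> M k b = 0.
Proof.
move=> /matrixP /(_ (inord k.-1) b); rewrite mul_JplusE [(0 : 'M_(_, _)) _ _]mxE.
move=> + k0; rewrite inordK ?(leq_ltn_trans (leq_pred _)) // prednK // inord_val.
have lN : (ladder R d k)%:C != 0 :> R[i].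
  by apply: ladderC_neq0; rewrite k0 -ltnS ltn_ord.
by move/eqP; rewrite mulf_eq0 (negPf lN) => /eqP.
Qed.

Lemma Jplus_Jminus_kernel n (M : 'M[R[i]]_(d.+1, n)) : (0 < d)%N ->
  Jplus *m M = 0 -> Jminus *m M = 0 -> M = 0.
Proof.
move=> d0 hp hm; apply/matrixP => k b; rewrite mxE.
case: (posnP k) => [k0|]; last exact: Jplus_kernel.
(* Row [1] exists because [0 < d], and in the product with [Jminus] it isolates row [0] of [M]. *)
move: hm => /matrixP /(_ (inord 1) b); rewrite mul_JminusE [(0 : 'M_(_, _)) _ _]mxE.
have lN : (ladder R d 1)%:C != 0 :> R[i] by apply: ladderC_neq0.
rewrite inordK //= => /eqP; rewrite mulf_eq0 (negPf lN) /=.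
by rewrite (_ : inord 0 = k) => [/eqP|] //; apply: val_inj; rewrite /= inordK.
Qed.

Lemma mul_mx_JminusE n (M : 'M[R[i]]_(n, d.+1)) a b :
  (M *m Jminus) a b = M a (inord b.+1) * (ladder R d b.+1)%:C.
Proof.
have [bd|db] := ltnP b d.
  rewrite mxE (bigD1 (inord b.+1)) //= JminusE inordK // eqxx big1 ?addr0 //.
  move=> c /eqP cb; rewrite JminusE; case: eqP => [cE|_]; last by rewrite mulr0.
  by case: cb; apply: val_inj; rewrite /= inordK.
have bE : b = d :> nat by apply/eqP; rewrite eqn_leq db -ltnS ltn_ord.
rewrite bE ladderS mulr0 mxE big1 // => c _; rewrite JminusE bE.
by rewrite ltn_eqF ?mulr0.
Qed.

(** Column [0] of [Jplus] is zero, so the first relation puts column [0] of [M] in the kernel of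
    [Jplus], the highest-weight line. The second relation then yields column [k + 1] from column
    [k], with a factor [q]. *)
Lemma ladder_diagonal (M : mx) (q : R[i]) :
  Jplus *m M = q *: (M *m Jplus) -> M *m Jminus = q *: (Jminus *m M) ->
  M = diag_mx (\row_k (M 0 0 * q ^+ k)).
Proof.
move=> hp hm.
have col0 (a : 'I_d.+1) : (0 < a)%N -> M a 0 = 0.
  move=> a0; have : Jplus *m col 0 M = 0.
    rewrite colE mulmxA hp -colE; apply/matrixP => x y; rewrite mxE mxZE.
    rewrite [(M *m _) _ _]mxE big1 ?mulr0 ?[RHS]mxE // => c _.
    by rewrite JplusE mulr0.
  by move=> hk; have := Jplus_kernel 0 hk a0; rewrite mxE.
suff E k (kd : (k < d.+1)%N) a : M a (Ordinal kd) = (M 0 0 * q ^+ k) *+ (a == Ordinal kd).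
  by apply/matrixP => a [k kd]; rewrite E !mxE; case: eqP => [->|].
elim: k kd a => [|k IH] kd a.
  rewrite expr0 mulr1 (_ : Ordinal kd = 0); last exact: val_inj.
  case: eqP => [->//|aN]; apply: col0; rewrite lt0n; apply/eqP => a0.
  by apply: aN; apply: val_inj.
have kd' : (k < d.+1)%N by apply: ltnW.
have /matrixP /(_ a (Ordinal kd')) := hm.
rewrite mul_mx_JminusE mxZE mul_JminusE IH /=.
have -> : inord k.+1 = Ordinal kd by apply: val_inj; rewrite /= inordK.
have lN : (ladder R d k.+1)%:C != 0 :> R[i] by apply: ladderC_neq0.
move=> E; apply: (mulIf lN); rewrite E.
case: (posnP a) => [a0|a0].
  by rewrite a0 ladder0 mul0r mulr0 -val_eqE /= a0 mulr0n mul0r.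
have -> : (inord a.-1 == Ordinal kd') = (a == Ordinal kd).
  rewrite -!val_eqE /= inordK ?(leq_ltn_trans (leq_pred _)) //.
  by rewrite -eqSS prednK.
case: eqP => [->|_] /=; last by rewrite !mulr0n mulr0 mulr0 mul0r.
by rewrite !mulr1n exprS; ring.
Qed.

(** The spectrum of [Jz] is simple, so [M] has a single nonzero row and is an outer product. *)
Lemma Jz_eigen n (M : 'M[R[i]]_(d.+1, n)) (l : R[i]) : Jz *m M = l *: M -> M != 0 ->
  exists k, l = (spin_m k)%:C /\ M = delta_mx k (0 : 'I_1) *m row k M.
Proof.
move=> hM M0; have [k [b kb]] : exists k b, M k b != 0.
  apply/not_existsP => h; move: M0; apply/negP; rewrite negbK; apply/eqP/matrixP => k b.
  rewrite mxE; apply/eqP/negP => kb; apply: (h k); exists b; exact/negP.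
have hl a c : M a c != 0 -> l = (spin_m a)%:C.
  move=> ac; have /matrixP /(_ a c) := hM; rewrite mul_JzE mxZE.
  by move/(mulIf ac).
exists k; split; first exact: hl kb.
apply/matrixP => a c; rewrite [RHS]mxE big_ord1 [row k M 0 c]mxE [delta_mx _ _ _ _]mxE andbT.
case: eqP => [->|ak]; first by rewrite mul1r.
rewrite mul0r; apply/eqP; apply: contra_notT ak => ac; apply: val_inj.
have := hl _ _ ac; rewrite (hl _ _ kb) => /complexI; rewrite /spin_m => /eqP.
by rewrite (inj_eq (addrI _)) eqr_opp eqr_nat => /eqP.
Qed.

(** Here [rho] is [phi0] times its adjoint, scaled by the squared norm of [y]; the root of this
    scalar is [a], and the unit trace of [rho] normalizes the vector. *)
Lemma rank_one_density (rho r : mx) (phi0 : 'cV[R[i]]_d.+1) (y : 'rV[R[i]]_d.+1) :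
  rho = r *m r^t* -> \tr rho = 1 -> r = phi0 *m y ->
  exists a, (a *: phi0)^t* *m (a *: phi0) = 1%:M /\
            rho = (a *: phi0) *m (a *: phi0)^t*.
Proof.
move=> rhoE tr1 rE; pose g := (y *m y^t*) 0 0.
have g0 : 0 <= g.
  rewrite /g mxE sumr_ge0 // => i _; rewrite !mxE; exact: mul_conjC_ge0.
have gE : g = sqrtC g * (sqrtC g)^*.
  by rewrite geC0_conj ?sqrtC_ge0 // -expr2 sqrtCK.
have phiE : rho = (sqrtC g *: phi0) *m (sqrtC g *: phi0)^t*.
  rewrite adjmxZ -scalemxAl -scalemxAr scalerA -gE rhoE rE adjmxM mulmxA.
  by rewrite -(mulmxA phi0) (mx11_scalar (y *m _)) mul_mx_scalar -scalemxAl.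
exists (sqrtC g); split=> //; rewrite [LHS]mx11_scalar; congr (_%:M).
by rewrite -tr1 phiE mxtrace_mulC [RHS]big_ord1.
Qed.

Definition xaxis : 'rV[R]_3 := row3 1 0 0.
Definition yaxis : 'rV[R]_3 := row3 0 1 0.
Definition zaxis : 'rV[R]_3 := row3 0 0 1.

Lemma Jdir_e1 : Jd xaxis = Jx.
Proof. by rewrite /Jdir !row3E scale1r !scale0r !addr0. Qed.

Lemma Jdir_e2 : Jd yaxis = Jy.
Proof. by rewrite /Jdir !row3E scale1r !scale0r addr0 add0r. Qed.

Lemma Jdir_e3 : Jd zaxis = Jz.
Proof. by rewrite /Jdir !row3E scale1r !scale0r !add0r. Qed.

Lemma frame_rotation3 (a b : 'rV[R]_3) :
  dotr a a = 1 -> dotr b b = 1 -> dotr a b = 0 ->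
  exists T : mx, [/\ rotation T, T *m Jx = Jd a *m T, T *m Jy = Jd b *m T &
    T *m Jz = Jd (cross a b) *m T].
Proof.
move=> aa bb ab; have [T [rT hT]] := frame_rotation d aa bb ab; exists T.
by split; rewrite // -?Jdir_e1 -?Jdir_e2 -?Jdir_e3 hT mul_frameE !row3E
  ?scale1r ?scale0r ?addr0 ?add0r.
Qed.

Lemma quarter_turn : let N : mx := mexp (- ('i * (pi / 2)%:C) *: Jy) in
  N *m Jz = Jx *m N.
Proof.
have e22 : dotr yaxis yaxis = 1 by rewrite dotrE !row3E; ring.
have e23 : dotr yaxis zaxis = 0 by rewrite dotrE !row3E; ring.
have := rotation_perp d (pi / 2) e22 e23; rewrite Jdir_e2 Jdir_e3.
rewrite cos_pihalf sin_pihalf scale0r add0r scale1r.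
have -> : cross yaxis zaxis = xaxis by rewrite /cross !row3E; congr row3; ring.
by rewrite Jdir_e1.
Qed.

Lemma boost_combination (C : numClosedFieldType) n (B P M X Y : 'M[C]_n) (p q : C) :
  P = X + 'i *: Y -> M = X - 'i *: Y ->
  B *m P = p *: (P *m B) -> B *m M = q *: (M *m B) ->
  B *m X = (((p + q) / 2) *: X + ('i * ((p - q) / 2)) *: Y) *m B.
Proof.
move=> -> -> h1 h2; apply: (@scalerI _ _ 2); first by rewrite pnatr_eq0.
transitivity (B *m (X + 'i *: Y) + B *m (X - 'i *: Y)).
  by rewrite !mxexpand; mxlin; ring.
by rewrite h1 h2 !mxexpand; clear; mxlin; field.
Qed.

(** The boost multiplies [Jplus] and [Jminus] by the exponentials of [b] and [- b]; for [Jx] this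
    gives the coefficients [cosh b] and ['i sinh b], written with [expR]. *)
Lemma boost_Jx (b : R) : let B : mx := mexp (b%:C *: Jz) in
  B *m Jx = (((expR b + expR (- b)) / 2)%:C *: Jx +
             ('i * ((expR b - expR (- b)) / 2)%:C) *: Jy) *m B.
Proof.
move=> B; have hp : Jz *m Jplus - Jplus *m Jz = 1%:C *: Jplus.
  by rewrite comm_Jz_Jplus scale1r.
have hm : Jz *m Jminus - Jminus *m Jz = (-1)%:C *: Jminus.
  by rewrite comm_Jz_Jminus rmorphN1 scaleN1r.
have := mexp_intertwine (exp_param_boost b) (adj_Jz R d) hp.
have := mexp_intertwine (exp_param_boost b) (adj_Jz R d) hm.
rewrite mulr1 mulrN1 -/B => hM hP.
rewrite (boost_combination (Jplus_decomp R d) (Jminus_decomp R d) hP hM).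
by rewrite !rmorphM fmorphV rmorph_nat rmorphB rmorphD.
Qed.

Lemma boost_unitmx (b : R) : mexp (b%:C *: Jz) \in unitmx.
Proof. exact: (mexp_unitmx (exp_param_boost b) (adj_Jz R d)). Qed.

Lemma quarter_turn_unitmx : mexp (- ('i * (pi / 2)%:C) *: Jy) \in unitmx.
Proof. exact: (mexp_unitmx (exp_param_rotation (pi / 2)) (adj_Jy R d)). Qed.

Lemma rotation_unitmx (T : mx) : rotation T -> T \in unitmx.
Proof. by move=> /rotation_unitary TT; have [U _] := mulmx1_unit TT; exact: U. Qed.

End SpinStates.

(** * Transport of relations along intertwiners *)

Lemma intertwine_inv (C : numClosedFieldType) n (T T' P P' : 'M[C]_n) :
  T *m T' = 1%:M -> T *m P' = P *m T -> T' *m P = P' *m T'.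
Proof.
move=> TT TP; have T'T := mulmx1C TT.
by rewrite -[LHS]mulmx1 -TT mulmxA -(mulmxA T' P) -TP mulmxA T'T mul1mx.
Qed.

Lemma conj_relation (C : numClosedFieldType) n (T T' P P' r : 'M[C]_n) k l :
  T *m T' = 1%:M -> T *m P' = P *m T -> k *: (P *m r) = l *: (r *m P) ->
  k *: (P' *m (T' *m r *m T)) = l *: ((T' *m r *m T) *m P').
Proof.
move=> TT TP Pr; have TP' := intertwine_inv TT TP.
transitivity (T' *m (k *: (P *m r)) *m T).
  by rewrite -scalemxAr -scalemxAl !mulmxA TP'.
by rewrite Pr -scalemxAr -scalemxAl -!mulmxA TP.
Qed.

Lemma conj_mul (C : numClosedFieldType) n (T T' A B : 'M[C]_n) :
  T *m T' = 1%:M -> T' *m (A *m B) *m T = (T' *m A *m T) *m (T' *m B *m T).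
Proof. by move=> TT; rewrite -!mulmxA (mulmxA T T') TT mul1mx. Qed.

Lemma unitmx_mul3 (C : numClosedFieldType) n (A B D : 'M[C]_n) :
  A \in unitmx -> B \in unitmx -> D \in unitmx -> A *m B *m D \in unitmx.
Proof. by rewrite !unitmx_mul => -> -> ->. Qed.

Lemma mulmx_intertwine3 (C : numClosedFieldType) n (T B N J J' K L : 'M[C]_n) :
  N *m J = J' *m N -> B *m J' = K *m B -> T *m K = L *m T ->
  (T *m B *m N) *m J = L *m (T *m B *m N).
Proof. by move=> NJ BJ TK; rewrite -mulmxA NJ mulmxA -(mulmxA T) BJ mulmxA TK !mulmxA. Qed.

Lemma eigen_of_intertwine (C : numClosedFieldType) n (S J L r : 'M[C]_n) l :
  S \in unitmx -> S *m J = L *m S -> L *m r = l *: r ->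
  J *m (invmx S *m r) = l *: (invmx S *m r).
Proof.
move=> SU SJ Lr; rewrite -[LHS](mulKmx SU) (mulmxA S) SJ -mulmxA (mulKVmx SU) Lr.
by rewrite scalemxAr.
Qed.

(** * Recognizing the forms of states *)

Section Forms.
Variables (R : realType) (d : nat).
Local Notation mx := ('M[R[i]]_d.+1).
Local Notation Jd := (@Jdir R d).
Local Notation Jx := (@Jx R d).
Local Notation Jy := (@Jy R d).
Local Notation Jz := (@Jz R d).
Implicit Types rho : mx.

(** With the normalizing sum left unevaluated, the case distinction of the closed form
    disappears. *)
Lemma geometric_weightE (q : R) (k : 'I_d.+1) :
  geometric_weight q k = q ^+ (2 * k) / \sum_(l < d.+1) q ^+ (2 * l).
Proof.
rewrite /geometric_weight; congr (_ * _); under eq_bigr do rewrite exprM.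
case: eqP => [->|/eqP q1].
  by under eq_bigr do rewrite expr1n; rewrite sumr_const card_ord.
have := subrX1 (q ^+ 2) d.+1; rewrite -exprM => /(congr1 -%R).
rewrite opprB -mulNr opprB => ->; rewrite invfM mulrA mulfV ?mul1r //.
by rewrite subr_eq0 eq_sym.
Qed.

Lemma dicke_outer (T : mx) k : T *m dicke k *m (dicke k)^t* *m T^t* =
  T *m delta_mx k k *m T^t*.
Proof.
congr (_ *m _); rewrite -mulmxA; congr (_ *m _).
by rewrite /dicke trmx_delta map_delta_mx mul_delta_mx.
Qed.

Lemma conj_rotationK (T M : mx) : rotation T -> M = T *m (T^t* *m M *m T) *m T^t*.
Proof.
move=> /rotation_unitary TT.
by rewrite !mulmxA TT mul1mx -mulmxA TT mulmx1.
Qed.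

(** Squaring turns the ratio [q] into [q ^+ 2], and the unit trace determines [c ^+ 2], the only way
    in which [c] enters [rho]. *)
Lemma geometric_of_diagonal rho r (T : mx) (q : R) (c : R[i]) :
  rotation T -> rho = r *m r -> \tr rho = 1 ->
  T^t* *m r *m T = diag_mx (\row_k (c * q%:C ^+ k)) -> geometric_form rho.
Proof.
move=> rT rhoE tr1 rE; exists T, q; split=> //.
pose S := \sum_(l < d.+1) q ^+ (2 * l).
have rho'E : T^t* *m rho *m T = \sum_(k < d.+1) (c ^+ 2 * (q ^+ (2 * k))%:C) *: delta_mx k k.
  have -> : T^t* *m rho *m T = (T^t* *m r *m T) *m (T^t* *m r *m T).
    by rewrite rhoE; apply: conj_mul; exact: rotation_unitary.
  rewrite rE mulmx_diag diag_mx_sum_delta; apply: eq_bigr => k _; congr (_ *: _).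
  by rewrite !mxE mulrACA -!expr2 -exprM mulnC rmorphXn.
have cS : c ^+ 2 * S%:C = 1.
  have : \tr (T^t* *m rho *m T) = 1.
    by rewrite mxtrace_mulC mulmxA rotation_unitary // mul1mx.
  rewrite rho'E raddf_sum /= => <-; rewrite /S rmorph_sum mulr_sumr.
  apply: eq_bigr => k _; rewrite mxtraceZ /mxtrace (bigD1 k) //= big1 ?addr0.
    by rewrite mxE eqxx mulr1.
  by move=> l /negPf lk; rewrite mxE lk.
have c2 : c ^+ 2 = (S^-1)%:C.
  have SN : S%:C != 0 :> R[i].
    by apply: contraTneq (oner_neq0 R[i]) => S0; rewrite -cS S0 mulr0 eqxx.
  by apply: (mulIf SN); rewrite cS -rmorphM mulVf // -(fmorph_eq0 (real_complex R)).
rewrite [LHS](conj_rotationK _ rT) rho'E mulmx_sumr mulmx_suml.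
apply: eq_bigr => k _; rewrite dicke_outer -scalemxAr -scalemxAl; congr (_ *: _).
by rewrite geometric_weightE -/S c2 mulrC rmorphM.
Qed.

Lemma rotated_diagonal_of_geometric rho : geometric_form rho -> rotated_diagonal rho.
Proof.
move=> [T [s [rT ->]]].
exists T, (\sum_(k < d.+1) (geometric_weight s k)%:C *: delta_mx k k); split=> //.
  apply/is_diag_mxP => i j ij; rewrite summxE big1 // => k _.
  rewrite mxZE mxE; case: eqP => [ik|]; rewrite ?mulr0 //=.
  by case: eqP => [jk|]; rewrite ?mulr0 // -jk in ik *; rewrite ik eqxx in ij.
rewrite mulmx_sumr mulmx_suml; apply: eq_bigr => k _.
by rewrite dicke_outer -scalemxAr -scalemxAl.
Qed.

Lemma rotated_pure_of_squeezed rho : squeezed_form rho -> rotated_pure rho.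
Proof.
move=> [T [b [k [a]]]]; set phi := a *: _; move=> [rT phi1 ->].
have TT := rotation_unitary rT.
exists T, (T^t* *m phi); split=> //.
  by rewrite adjmxM trmxCK mulmxA -(mulmxA (phi^t*)) TT mulmx1.
by rewrite adjmxM trmxCK !mulmxA TT mul1mx -!mulmxA TT mulmx1.
Qed.

(** After a rotation that takes the third axis to [cross a b], the state commutes with [Jz], whose
    spectrum is simple. *)
Lemma rotated_diagonal_of_comm rho (a b : 'rV[R]_3) :
  dotr a a = 1 -> dotr b b = 1 -> dotr a b = 0 ->
  rho *m Jd (cross a b) = Jd (cross a b) *m rho -> rotated_diagonal rho.
Proof.
move=> aa bb ab comm; have [T [rT _ _ Tz]] := frame_rotation3 d aa bb ab.
exists T, (T^t* *m rho *m T); split=> //; last exact: conj_rotationK.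
have := conj_relation (k := 1) (l := 1) (r := rho) (rotation_unitary rT) Tz.
rewrite !scale1r => /(_ (esym comm)).
move: (_ *m T) => M hM; apply/is_diag_mxP => i j ij.
have /matrixP /(_ i j) := hM; rewrite mul_JzE mul_mx_JzE mulrC => /eqP.
rewrite -subr_eq0 -mulrBr mulf_eq0 => /orP[/eqP //|].
rewrite subr_eq0 => /eqP /complexI; rewrite /spin_m => /eqP.
by rewrite (inj_eq (addrI _)) eqr_opp eqr_nat (negPf ij).
Qed.

(** The product [S] of the rotation, the boost and the quarter turn carries [Jz] to [L]. Hence
    [invmx S *m sqrtmx rho] consists of eigenvectors of [Jz], and the range of [sqrtmx rho] is the
    line of [S *m dicke k]. *)
Lemma squeezed_of_eigen rho (T L : mx) (b : R) (l : R[i]) : density rho -> rotation T ->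
  T *m (((expR b + expR (- b)) / 2)%:C *: Jx +
        ('i * ((expR b - expR (- b)) / 2)%:C) *: Jy) = L *m T ->
  L *m sqrtmx rho = l *: sqrtmx rho ->
  squeezed_form rho /\ exists k : 'I_d.+1, l = (spin_m k)%:C.
Proof.
move=> rhoD rT TL Lr; have [rho_psd tr1] := rhoD.
pose S := T *m mexp (b%:C *: Jz) *m mexp (- ('i * (pi / 2)%:C) *: Jy).
have SU : S \in unitmx.
  apply: unitmx_mul3; first exact: rotation_unitmx.
    exact: boost_unitmx.
  exact: quarter_turn_unitmx.
have SJz : S *m Jz = L *m S.
  have NJz := quarter_turn R d; have BJx := boost_Jx d b; rewrite /= in NJz BJx.
  exact: mulmx_intertwine3 NJz BJx TL.
have JM : Jz *m (invmx S *m sqrtmx rho) = l *: (invmx S *m sqrtmx rho).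
  exact: (eigen_of_intertwine SU SJz Lr).
have rE : sqrtmx rho = S *m (invmx S *m sqrtmx rho) by rewrite (mulKVmx SU).
move: (invmx S *m sqrtmx rho) JM rE => M JM rE.
have M0 : M != 0.
  by apply: contraNneq (sqrt_density_neq0 rhoD) => M0; rewrite rE M0 mulmx0.
have [k [lE ME]] := Jz_eigen JM M0; split; last by exists k.
have r2 : rho = sqrtmx rho *m (sqrtmx rho)^t*.
  by rewrite (psd_adj (sqrtmx_psd rho_psd)) sqrtmxK.
have rE' : sqrtmx rho = (S *m dicke k) *m row k M by rewrite -mulmxA -ME.
have [a [aN aE]] := rank_one_density r2 tr1 rE'.
by exists T, b, k, a.
Qed.

End Forms.

(** * The equations for three observables with angular momentum commutation relations *)

Lemma comm_centered (C : comPzRingType) n (X Y : 'M[C]_n) (x y : C) :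
  (X - x%:M) *m (Y - y%:M) - (Y - y%:M) *m (X - x%:M) = X *m Y - Y *m X.
Proof.
rewrite !mulmxBl !mulmxBr !mul_scalar_mx !mul_mx_scalar !scale_scalar_mx.
by rewrite (mulrC y); move: (x * y)%:M => W; mxlin; ring.
Qed.

Lemma comm_mx_centered (C : comPzRingType) n (r X : 'M[C]_n) (x : C) :
  r *m (X - x%:M) - (X - x%:M) *m r = r *m X - X *m r.
Proof.
by rewrite !mulmxBl !mulmxBr mul_scalar_mx mul_mx_scalar; mxlin; ring.
Qed.

Section AbstractEquations.
Variables (C : numClosedFieldType) (n : nat) (rho X Y Z : 'M[C]_n) (s t : C).
Hypothesis rho_density : density rho.
Hypotheses (hX : X^t* = X) (hY : Y^t* = Y).
Hypotheses (xy : X *m Y - Y *m X = 'i *: Z) (yz : Y *m Z - Z *m Y = 'i *: X)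
  (zx : Z *m X - X *m Z = 'i *: Y).
Local Notation r := (sqrtmx rho).
Hypothesis nondegenerate : ~ (r *m X = 0 /\ r *m Y = 0).
Hypotheses
  (e1 : ('i * s) *: commutator_mx r X + anticommutator_mx r (centered rho Y) = 0)
  (e2 : ('i * t) *: commutator_mx r Y + anticommutator_mx r (centered rho X) = 0).
Local Notation x := (\tr (rho *m X)).
Local Notation y := (\tr (rho *m Y)).

Let f1 : ('i * s) *: (r *m X - X *m r) + (r *m Y + Y *m r) = (2 * y) *: r.
Proof.
move: e1; rewrite anticommutator_centered /commutator_mx => /eqP.
by rewrite addrA subr_eq0 => /eqP.
Qed.

Let f2 : ('i * t) *: (r *m Y - Y *m r) + (r *m X + X *m r) = (2 * x) *: r.
Proof.
move: e2; rewrite anticommutator_centered /commutator_mx => /eqP.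
by rewrite addrA subr_eq0 => /eqP.
Qed.

Let g1 : ('i * s) *: (r *m centered rho X - centered rho X *m r) +
  (r *m centered rho Y + centered rho Y *m r) = 0.
Proof. by rewrite {1 2}/centered comm_mx_centered. Qed.

Let g2 : ('i * t) *: (r *m centered rho Y - centered rho Y *m r) +
  (r *m centered rho X + centered rho X *m r) = 0.
Proof. by rewrite {1 2}/centered comm_mx_centered. Qed.

Lemma equality_equations_dichotomy : s * t = -1 \/ [/\ s = - t, x = 0 & y = 0].
Proof.
have xy0 : centered rho X *m centered rho Y - centered rho Y *m centered rho X = 'i *: Z.
  by rewrite /centered comm_centered.
have /eqP := equations_commute xy0 g1 g2; rewrite scaler_eq0 => /orP[st|rz].
  by left; apply/eqP; rewrite -subr_eq0 opprK addrC.
right; have {rz} rz : r *m Z = Z *m r by apply/eqP; rewrite -subr_eq0.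
have zy : Z *m Y - Y *m Z = - 'i *: X by rewrite -opprB yz scaleNr.
have trN := sqrt_density_trace_neq0 rho_density.
have [x0 y0 sX sY] := equations_diagonal trN zx zy rz f1 f2; split=> //.
(* If [s + t] were nonzero, [X] and [Y] would commute with [r]; since the means are zero, the
   equations would also make them anticommute with [r], so that [r X = r Y = 0]. *)
apply/eqP; rewrite -subr_eq0 opprK; apply/negP => /negP st0; apply: nondegenerate.
have half V : r *m V - V *m r = 0 -> r *m V + V *m r = 0 -> r *m V = 0.
  move=> h1 h2; apply: (@scalerI _ _ 2); first by rewrite pnatr_eq0.
  by rewrite scaler0 -[RHS]h2 scaler_nat mulr2n -{2}[r *m V](subrK (V *m r)) h1 add0r.
move: sX sY => /eqP; rewrite scaler_eq0 (negPf st0) /= => /eqP rX.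
move=> /eqP; rewrite scaler_eq0 (negPf st0) /= => /eqP rY.
move: f1 f2; rewrite rX rY x0 y0 mulr0 !scale0r !scaler0 !add0r => gY gX.
by split; apply: half.
Qed.

(** If the mean of [Z] vanished, [r] would annihilate the centered [X] and [Y], hence their
    commutator [Z], hence the commutators of [Z] with them, which are the uncentered [X] and [Y]. *)
Lemma mean_cross_neq0 : \tr (rho *m Z) <> 0.
Proof.
move=> tau0; apply: nondegenerate.
have [rX rY] := kernel_of_equations rho_density hX hY xy e1 e2 tau0.
have mulC U V W : r *m U = 0 -> r *m V = 0 -> U *m V - V *m U = 'i *: W -> r *m W = 0.
  move=> rU rV UV; apply: (scalerI (neq0Ci C)).
  by rewrite scaler0 scalemxAr -UV mulmxBr !mulmxA rU rV !mul0mx subrr.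
have rZ : r *m Z = 0 by apply: (mulC _ _ _ rX rY); rewrite comm_centered.
have Z0 : Z = Z - 0%:M by rewrite raddf0 subr0.
split; [apply: (mulC _ _ _ rY rZ) | apply: (mulC _ _ _ rZ rX)];
  by rewrite {1 2}Z0 comm_centered.
Qed.

Lemma ladder_of_equations : t = - s -> x = 0 -> y = 0 ->
  (1 + s) *: ((X + 'i *: Y) *m r) = (s - 1) *: (r *m (X + 'i *: Y)) /\
  (1 + s) *: (r *m (X - 'i *: Y)) = (s - 1) *: ((X - 'i *: Y) *m r).
Proof.
move=> ts x0 y0; move: f1 f2; rewrite ts x0 y0 mulr0 scale0r => h1 h2.
exact: equations_ladder.
Qed.

Lemma squeezed_of_equations : s * t = -1 ->
  (Y - ('i * s) *: X) *m r = (y - 'i * s * x) *: r.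
Proof.
move=> st; have := equations_squeezed st g1 g2; rewrite /centered.
move: (\tr _) (\tr _) => p q; rewrite !mxexpand !mul_scalar_mx => h.
by apply/eqP; rewrite -subr_eq0 -h; apply/eqP; mxlin; ring.
Qed.

End AbstractEquations.

(** * Geometric states: the case [s = - t] *)

Section Equations.
Variables (R : realType) (d : nat).
Hypothesis d_gt0 : (0 < d)%N.
Local Notation mx := ('M[R[i]]_d.+1).
Local Notation Jd := (@Jdir R d).
Local Notation Jx := (@Jx R d).
Local Notation Jy := (@Jy R d).
Local Notation Jz := (@Jz R d).
Variable rho : mx.
Hypothesis rho_density : density rho.
Local Notation r := (sqrtmx rho).

Let rho_psd : psdmx rho. Proof. by case: rho_density. Qed.
Let r_psd : psdmx r. Proof. exact: sqrtmx_psd. Qed.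
Let r_adj : r^t* = r. Proof. exact: psd_adj. Qed.
Let rr : r *m r = rho. Proof. exact: sqrtmxK. Qed.

Lemma mean_real v : exists x : R, \tr (rho *m Jd v) = x%:C.
Proof. by apply/complex_realP/density_trace_real => //; exact: adj_Jdir. Qed.

Lemma equality_equations_sym n1 n2 (s t : R) :
  equality_equations rho n1 n2 s t -> equality_equations rho n2 n1 t s.
Proof. by case. Qed.

Section Pair.
Variables n1 n2 : 'rV[R]_3.
Hypotheses (aa : dotr n1 n1 = 1) (bb : dotr n2 n2 = 1) (ab : dotr n1 n2 = 0).
Local Notation X := (Jd n1).
Local Notation Y := (Jd n2).
Local Notation Z := (Jd (cross n1 n2)).
Local Notation x := (\tr (rho *m X)).
Local Notation y := (\tr (rho *m Y)).

(** This is where the spin must be positive: after a rotation, [Jplus] and [Jminus] would both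
    annihilate a nonzero matrix. *)
Lemma sqrt_density_nondegenerate : ~ (r *m X = 0 /\ r *m Y = 0).
Proof.
move=> [rX rY]; have [T [rT Tx Ty _]] := frame_rotation3 d aa bb ab.
have TT := rotation_unitary rT.
have adj0 v : r *m Jd v = 0 -> Jd v *m r = 0.
  move=> h; have := congr1 (fun M => M^t*) h.
  by rewrite /= adjmxM r_adj adj_Jdir trmx0 map_mx0.
have mul0 (P P' : mx) : T *m P' = P *m T -> P *m r = 0 -> P' *m (T^t* *m r) = 0.
  by move=> TP Pr; rewrite mulmxA -(intertwine_inv TT TP) -mulmxA Pr mulmx0.
have x0 := mul0 _ _ Tx (adj0 _ rX); have y0 := mul0 _ _ Ty (adj0 _ rY).
have : T^t* *m r = 0.
  apply: (Jplus_Jminus_kernel d_gt0).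
    by rewrite Jplus_decomp mulmxDl -(scalemxAl 'i) x0 y0 scaler0 addr0.
  by rewrite Jminus_decomp mulmxBl -(scalemxAl 'i) x0 y0 scaler0 subr0.
move=> /(congr1 (mulmx T)); rewrite mulmxA TT mul1mx mulmx0 => r0.
by have := sqrt_density_neq0 rho_density; rewrite r0 eqxx.
Qed.

Lemma geometric_of_equations (s : R) : 0 <= s -> equality_equations rho n1 n2 s (- s) ->
  x = 0 -> y = 0 -> geometric_form rho.
Proof.
move=> s0 [e1 e2] x0 y0; rewrite rmorphN in e2.
have [hp hm] := ladder_of_equations e1 e2 (erefl _) x0 y0.
have [T [rT Tx Ty _]] := frame_rotation3 d aa bb ab.
have TT := rotation_unitary rT.
have Tp : T *m Jplus = (X + 'i *: Y) *m T.
  by rewrite Jplus_decomp mulmxDr mulmxDl -(scalemxAr 'i) -(scalemxAl 'i) Tx Ty.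
have Tm : T *m Jminus = (X - 'i *: Y) *m T.
  by rewrite Jminus_decomp mulmxBr mulmxBl -(scalemxAr 'i) -(scalemxAl 'i) Tx Ty.
have gp := conj_relation TT Tp hp.
have gm := esym (conj_relation TT Tm (esym hm)).
(* From [0 <= s] one may divide by [1 + s], which gives both ladder relations the common ratio
   [(s - 1) / (1 + s)]. *)
have sN : 1 + s != 0 by rewrite gt_eqF // ltr_wpDr.
have sE : (1 + s)%:C = 1 + s%:C :> R[i] by rewrite rmorphD.
have s1 : (1 + s)%:C != 0 :> R[i] by rewrite fmorph_eq0.
have scale (A B : mx) : (1 + s%:C) *: A = (s%:C - 1) *: B ->
    A = ((s - 1) / (1 + s))%:C *: B.
  rewrite -sE => h; apply: (scalerI s1); rewrite h scalerA -rmorphM mulrCA mulfV // mulr1.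
  by rewrite rmorphB.
have [_ tr1] := rho_density.
exact: (geometric_of_diagonal rT (esym rr) tr1 (ladder_diagonal (scale _ _ gp) (scale _ _ gm))).
Qed.

End Pair.
End Equations.

(** * Squeezed states: the case [s t = -1] *)

Lemma intertwine_boosted (C : numClosedFieldType) n (T A B A' B' : 'M[C]_n) p q :
  T *m A = A' *m T -> T *m B = - B' *m T ->
  T *m (p *: A + q *: B) = (p *: A' - q *: B') *m T.
Proof. by move=> hA hB; rewrite !mxexpand hA hB mulNmx scalerN. Qed.

Lemma eigen_boosted (C : numClosedFieldType) n (X Y r : 'M[C]_n) c s l :
  (Y - ('i * s) *: X) *m r = l *: r ->
  (c *: Y - ('i * (s * c)) *: X) *m r = (c * l) *: r.
Proof.
move=> h; rewrite -[RHS]scalerA -h scalemxAl; congr (_ *m _).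
by rewrite scalerBr scalerA; congr (_ - _ *: _); ring.
Qed.

Lemma eigen_conj (C : numClosedFieldType) n (T' P P' r : 'M[C]_n) l :
  T' *m P = P' *m T' -> P *m r = l *: r -> P' *m (T' *m r) = l *: (T' *m r).
Proof. by move=> TP Pr; rewrite mulmxA -TP -mulmxA Pr scalemxAr. Qed.

Section SqueezedForm.
Variables (R : realType) (d : nat).
Local Notation mx := ('M[R[i]]_d.+1).
Local Notation Jd := (@Jdir R d).
Local Notation Jx := (@Jx R d).
Local Notation Jy := (@Jy R d).
Local Notation Jz := (@Jz R d).
Local Notation Jplus := (@Jplus R d).

(** Squaring ['i q = p - m] equates [- q^2] with a real square, so both are zero. *)
Lemma imag_eq0 (p q m : R) : p%:C - 'i * q%:C = m%:C :> R[i] -> q = 0.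
Proof.
move=> h; have h1 : 'i * q%:C = (p - m)%:C :> R[i].
  have -> : (p - m)%:C = p%:C - m%:C :> R[i] by rewrite rmorphB.
  by rewrite -h opprB addrC subrK.
have : (- q ^+ 2)%:C = ((p - m) ^+ 2)%:C :> R[i].
  have -> : ((p - m) ^+ 2)%:C = (p - m)%:C ^+ 2 :> R[i] by rewrite rmorphXn.
  by rewrite -h1 exprMn sqrCi mulN1r rmorphN rmorphXn.
move=> /complexI E; have q0 := sqr_ge0 q; have := sqr_ge0 (p - m); rewrite -E => q1.
by apply/eqP; rewrite -sqrf_eq0; apply/eqP; lra.
Qed.

(** [Jplus] is nilpotent: for [l] nonzero each row of [M] is a multiple of the next one, and the
    last row is zero. *)
Lemma Jplus_eigen n (M : 'M[R[i]]_(d.+1, n)) l : Jplus *m M = l *: M -> M != 0 -> l = 0.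
Proof.
move=> hM M0; apply/eqP; apply: contraNT M0 => l0; apply/eqP/matrixP => k b.
rewrite [RHS]mxE; move: k.
have step (k : 'I_d.+1) : l * M k b = (ladder R d k.+1)%:C * M (inord k.+1) b.
  by have /matrixP /(_ k b) := hM; rewrite mul_JplusE mxZE.
suff H m (k : 'I_d.+1) : (k + m = d)%N -> M k b = 0.
  by move=> k; apply: (H (d - k)%N); rewrite subnKC // -ltnS ltn_ord.
elim: m k => [|m IH] k km; apply: (mulfI l0); rewrite mulr0 step.
  by rewrite addn0 in km; rewrite km ladderS mul0r.
have kd : (k.+1 < d.+1)%N by rewrite ltnS (leq_trans (leq_addr m k.+1)) // addSnnS km.
by rewrite IH ?mulr0 // inordK // addSnnS.
Qed.

Lemma Jz_of_Jplus_kernel n (M : 'M[R[i]]_(d.+1, n)) :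
  Jplus *m M = 0 -> Jz *m M = (spin_m (0 : 'I_d.+1))%:C *: M.
Proof.
move=> hM; apply/matrixP => k b; rewrite mul_JzE mxZE.
case: (posnP k) => [k0|k0]; last by rewrite (Jplus_kernel b hM k0) !mulr0.
by rewrite /spin_m k0.
Qed.

Lemma artanh_exists (s : R) : -1 < s -> s < 1 ->
  exists b, (expR b - expR (- b)) / 2 = s * ((expR b + expR (- b)) / 2).
Proof.
move=> s1 s2; have E0 : 0 < (1 + s) / (1 - s).
  by rewrite divr_gt0 // ?subr_gt0 // -ltrBlDl sub0r.
(* The witness [ln E] is the inverse hyperbolic tangent of [s]: its double has exponential
   [(1 + s) / (1 - s)]. *)
pose E := Num.sqrt ((1 + s) / (1 - s)).
have Egt0 : 0 < E by rewrite sqrtr_gt0.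
have sN : 1 - s != 0 by rewrite subr_eq0 eq_sym lt_eqF.
have E2 : E * E * (1 - s) = 1 + s by rewrite -expr2 sqr_sqrtr ?ltW // divfK.
exists (ln E); rewrite expRN lnK //; have EN := lt0r_neq0 Egt0.
rewrite mulrA; congr (_ / 2); apply: (mulfI EN).
by rewrite mulrCA mulrBr mulrDr !mulfV //; lra.
Qed.

Variable rho : mx.
Hypothesis rho_density : density rho.
Local Notation r := (sqrtmx rho).
Variables n1 n2 : 'rV[R]_3.
Hypotheses (aa : dotr n1 n1 = 1) (bb : dotr n2 n2 = 1) (ab : dotr n1 n2 = 0).
Local Notation X := (Jd n1).
Local Notation Y := (Jd n2).
Local Notation Z := (Jd (cross n1 n2)).
Local Notation x := (\tr (rho *m X)).
Local Notation y := (\tr (rho *m Y)).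

(** In this frame a boosted [Jx], that is [cosh b Jx + 'i sinh b Jy], is carried to
    [cosh b Y - 'i sinh b X]. *)
Let quarter_frame : exists T : mx, [/\ rotation T, T *m Jx = Y *m T,
  T *m Jy = - X *m T & T *m Jz = Z *m T].
Proof.
have aa' : dotr (- n1) (- n1) = 1 by rewrite -aa !dotrE !mxNE; ring.
have ab' : dotr n2 (- n1) = 0.
  by rewrite -oppr0 -ab !dotrE !mxNE; ring.
have [T [rT Tx Ty Tz]] := frame_rotation3 d bb aa' ab'; exists T.
have cE : cross n2 (- n1) = cross n1 n2 by apply: row3P; rewrite !crossE !mxNE; ring.
by rewrite cE in Tz; rewrite JdirN in Ty.
Qed.

(** For [tanh b = s] and [ch = cosh b], the operator [ch (Y - 'i s X)] is a rotated and boosted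
    [Jx]. Its eigenvalue [ch (y0 - 'i s x0)] is thus a magnetic quantum number, and being real it
    forces [s x0 = 0]. *)
Lemma squeezed_generic (s : R) (x0 y0 : R) : -1 < s -> s < 1 ->
  (Y - ('i * s%:C) *: X) *m r = (y0%:C - 'i * s%:C * x0%:C) *: r ->
  squeezed_form rho /\ s * x0 = 0.
Proof.
move=> s1 s2 eigen; have [b bE] := artanh_exists s1 s2.
have [T [rT Tx Ty Tz]] := quarter_frame.
set ch := (expR b + expR (- b)) / 2 in bE.
have chN : ch != 0 by rewrite gt_eqF // divr_gt0 // addr_gt0 // expR_gt0.
have TL := intertwine_boosted ch%:C ('i * (s%:C * ch%:C)) Tx Ty.
have Lr := eigen_boosted ch%:C eigen.
rewrite (_ : s%:C * ch%:C = ((expR b - expR (- b)) / 2)%:C) in TL Lr; last first.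
  by rewrite bE; exact: esym (rmorphM (real_complex R) s ch).
have [sq [k kE]] := squeezed_of_eigen rho_density rT TL Lr; split=> //.
have : (ch * y0)%:C - 'i * (ch * (s * x0))%:C = (spin_m k)%:C :> R[i].
  by rewrite -kE !rmorphM; ring.
by move=> /imag_eq0 /eqP; rewrite mulf_eq0 (negPf chN) => /eqP.
Qed.

(* Here [Y - i X] is a raising operator and [rho] a coherent state along
   [n1 x n2]: it is of the squeezed form with [beta = 0], but for a rotation that
   takes [Jx], not [Jz], to the direction [n1 x n2]. *)
Lemma squeezed_coherent (x0 y0 : R) :
  (Y - 'i *: X) *m r = (y0%:C - 'i * x0%:C) *: r ->
  [/\ squeezed_form rho, x0 = 0 & y0 = 0].
Proof.
move=> eigen; have [T [rT Tx Ty Tz]] := quarter_frame.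
have TT := rotation_unitary rT.
have Tp : T *m Jplus = (Y - 'i *: X) *m T.
  have := intertwine_boosted 1 'i Tx Ty; rewrite !scale1r -(Jplus_decomp R d); exact.
have rE : r = T *m (T^t* *m r) by rewrite mulmxA TT mul1mx.
have hM : Jplus *m (T^t* *m r) = (y0%:C - 'i * x0%:C) *: (T^t* *m r).
  exact: eigen_conj (intertwine_inv TT Tp) eigen.
move: (T^t* *m r) rE hM => M rE hM.
have M0 : M != 0.
  by apply: contraNneq (sqrt_density_neq0 rho_density) => M0; rewrite rE M0 mulmx0 eqxx.
have l0 := Jplus_eigen hM M0; rewrite l0 scale0r in hM.
have x00 : x0 = 0 by apply: (@imag_eq0 y0 x0 0).
have y00 : y0 = 0 by apply/complexI; rewrite [RHS]rmorph0 -l0 x00 rmorph0 mulr0 subr0.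
split=> //; have Jr := Jz_of_Jplus_kernel hM.
have Zr : Z *m r = (spin_m (0 : 'I_d.+1))%:C *: r.
  by rewrite rE mulmxA -Tz -mulmxA Jr scalemxAr.
have cc : dotr (cross n1 n2) (cross n1 n2) = 1.
  by rewrite dotr_cross_cross aa bb ab mulr1 expr0n subr0.
have ca : dotr (cross n1 n2) n1 = 0.
  by rewrite -(dotr_crossl n1 n2) !dotrE; ring.
have [T2 [rT2 T2x _ _]] := frame_rotation3 d cc aa ca.
have T2L : T2 *m (((expR 0 + expR (- 0)) / 2)%:C *: Jx +
    ('i * ((expR 0 - expR (- 0)) / 2)%:C) *: Jy) = Z *m T2.
  have -> : (expR 0 + expR (- 0)) / 2 = 1 :> R by rewrite oppr0 expR0; lra.
  have -> : (expR 0 - expR (- 0)) / 2 = 0 :> R by rewrite oppr0 expR0; lra.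
  by rewrite rmorph0 rmorph1 mulr0 scale0r scale1r addr0.
by have [] := squeezed_of_eigen rho_density rT2 T2L Zr.
Qed.

Lemma squeezed_of_equality_equations (s t : R) : s * t = -1 -> -1 < s <= 1 ->
  equality_equations rho n1 n2 s t ->
  [/\ squeezed_form rho, x = 0 & s = 1 -> y = 0].
Proof.
move=> st /andP[s1 s2] [e1 e2].
have stC : s%:C * t%:C = -1 :> R[i] by rewrite -rmorphM st rmorphN1.
have eigen := squeezed_of_equations e1 e2 stC.
have [x0 xE] := mean_real rho_density n1; have [y0 yE] := mean_real rho_density n2.
rewrite xE yE in eigen; rewrite xE yE.
have [s_lt1|s_ge1] := ltP s 1.
  have [sq sx] := squeezed_generic s1 s_lt1 eigen; split=> //.
    have sN : s != 0 by apply: contra_eq_neq st => ->; rewrite mul0r eq_sym oppr_eq0 oner_eq0.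
    by move/eqP: sx; rewrite mulf_eq0 (negPf sN) => /eqP ->.
  by move=> s_eq1; rewrite s_eq1 ltxx in s_lt1.
have sE : s = 1 by apply/eqP; rewrite eq_le s2.
rewrite sE mulr1 in eigen.
by have [sq -> ->] := squeezed_coherent eigen.
Qed.

End SqueezedForm.

(** * Vanishing uncertainties and the case analysis *)

Lemma eq_norm_neq0 (C : numDomainType) (p q : C) :
  `|p| = `|q| -> (p <> 0 <-> q <> 0).
Proof.
move=> pq; have pq0 : (p == 0) = (q == 0) by rewrite -normr_eq0 pq normr_eq0.
by split=> h /eqP h0; apply: h; apply/eqP; rewrite ?pq0 // -pq0.
Qed.

(** Either the skew information is zero and [X] commutes with the root of [rho], or the
    anticommutator with the centered [X] is zero and both products with it vanish. *)
Lemma comm_of_uncertainty_eq0 (C : numClosedFieldType) n (rho X : 'M[C]_n) :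
  density rho -> X^t* = X -> uncertainty rho X = 0 -> rho *m X = X *m rho.
Proof.
move=> rhoD hX; have [rho_psd _] := rhoD; have r_psd := sqrtmx_psd rho_psd.
have hc := adj_centered rhoD hX.
suff rX : uncertainty rho X = 0 -> sqrtmx rho *m X - X *m sqrtmx rho = 0.
  move=> /rX /eqP; rewrite subr_eq0 => /eqP comm; rewrite -(sqrtmxK rho_psd).
  by rewrite -mulmxA comm mulmxA comm mulmxA.
move/eqP; rewrite sqrtC_eq0 mulf_eq0 (skew_infoE rhoD) => /orP[] /eqP.
  move=> /eqP; rewrite mulf_eq0 invr_eq0 pnatr_eq0 /= => /eqP.
  move=> /(trace_sqr_eq0 (adj_commutator rhoD hX)) /eqP.
  by rewrite scaler_eq0 (negPf (neq0Ci C)) => /eqP.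
move=> /eqP; rewrite mulf_eq0 invr_eq0 pnatr_eq0 /= => /eqP.
move=> /(trace_sqr_eq0 (adj_anticommutator rhoD hX)).
move=> /(psd_anticommutator_eq0 r_psd hc) rX.
have Xr : centered rho X *m sqrtmx rho = 0.
  have := congr1 (fun M => M^t*) rX.
  by rewrite /= adjmxM hc (psd_adj r_psd) trmx0 map_mx0.
by rewrite -(comm_mx_centered _ _ (\tr (rho *m X))) -/(centered rho X) rX Xr subrr.
Qed.

Section Cases.
Variables (R : realType) (d : nat).
Hypothesis d_gt0 : (0 < d)%N.
Local Notation Jd := (@Jdir R d).
Variable rho : 'M[R[i]]_d.+1.
Hypothesis rho_density : density rho.

Section Ordered.
Variables n1 n2 : 'rV[R]_3.
Hypotheses (aa : dotr n1 n1 = 1) (bb : dotr n2 n2 = 1) (ab : dotr n1 n2 = 0).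
Local Notation x := (\tr (rho *m Jd n1)).
Local Notation y := (\tr (rho *m Jd n2)).

Let xy := comm_Jdir d n1 n2.
Let yz : Jd n2 *m Jd (cross n1 n2) - Jd (cross n1 n2) *m Jd n2 = 'i *: Jd n1.
Proof. by have h := comm_Jdir d n2 (cross n1 n2); rewrite (cross_bc bb ab) in h; exact: h. Qed.
Let zx : Jd (cross n1 n2) *m Jd n1 - Jd n1 *m Jd (cross n1 n2) = 'i *: Jd n2.
Proof. by have h := comm_Jdir d (cross n1 n2) n1; rewrite (cross_ca aa ab) in h; exact: h. Qed.
Let nondegenerate := sqrt_density_nondegenerate d_gt0 rho_density aa bb ab.

Lemma equality_parameters (s t : R) : equality_equations rho n1 n2 s t ->
  s * t = -1 \/ [/\ s = - t, x = 0 & y = 0].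
Proof.
move=> [e1 e2].
have [st|[st x0 y0]] := equality_equations_dichotomy rho_density xy yz zx nondegenerate e1 e2.
  left; apply/complexI; rewrite rmorphN1 -st; exact: rmorphM.
right; split; [apply/complexI | exact: x0 | exact: y0].
by rewrite st; exact: esym (rmorphN (real_complex R) t).
Qed.

Lemma equality_mean_cross_neq0 (s t : R) : equality_equations rho n1 n2 s t ->
  \tr (rho *m Jd (cross n1 n2)) <> 0.
Proof.
move=> [e1 e2]; exact: (mean_cross_neq0 rho_density (adj_Jdir d n1) (adj_Jdir d n2)
  xy yz zx nondegenerate e1 e2).
Qed.

Lemma minimum_uncertainty_equations (n3 : 'rV[R]_3) :
  `|\tr (rho *m Jd n3)| = `|\tr (rho *m Jd (cross n1 n2))| ->
  (minimum_uncertainty rho n1 n2 n3 /\ \tr (rho *m Jd n3) <> 0 <->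
   exists s t : R, equality_equations rho n1 n2 s t).
Proof.
move=> n3E; rewrite /minimum_uncertainty n3E.
have n30 : \tr (rho *m Jd n3) <> 0 <-> \tr (rho *m Jd (cross n1 n2)) <> 0.
  exact: eq_norm_neq0.
split=> [[E /n30 /eqP tauN]|[s [t eqs]]].
  have [s [t [/complex_realP[s' ->] /complex_realP[t' ->] e1 e2]]] :=
    equations_of_equality rho_density (adj_Jdir d n1) (adj_Jdir d n2) (adj_Jdir d _) xy tauN E.
  by exists s', t'; split; [exact: e1 | exact: e2].
split; last exact/n30/(equality_mean_cross_neq0 eqs).
have [e1 e2] := eqs.
exact: (equality_of_equations rho_density (adj_Jdir d n1) (adj_Jdir d n2) (adj_Jdir d _) xy e1 e2).
Qed.

Lemma rotated_diagonal_of_uncertainty :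
  uncertainty rho (Jd n1) = 0 -> rotated_diagonal rho.
Proof.
move=> /(comm_of_uncertainty_eq0 rho_density (adj_Jdir d n1)) comm.
have cc : dotr (cross n1 n2) (cross n1 n2) = 1.
  by rewrite dotr_cross_cross aa bb ab mulr1 expr0n subr0.
apply: (rotated_diagonal_of_comm bb cc (dotr_crossr n1 n2)).
by rewrite (cross_bc bb ab).
Qed.

Lemma geometric_of_condition (s t : R) : equality_equations rho n1 n2 s t ->
  s = - t -> x = 0 -> y = 0 -> 0 <= s -> geometric_form rho.
Proof.
move=> eqs st x0 y0 s0; apply: (geometric_of_equations rho_density aa bb ab s0 _ x0 y0).
by rewrite {2}st opprK.
Qed.

End Ordered.

Variables n1 n2 n3 : 'rV[R]_3.
Hypothesis hn : orthonormal_basis3 n1 n2 n3.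
Let aa : dotr n1 n1 = 1. Proof. by case: hn => -[]. Qed.
Let bb : dotr n2 n2 = 1. Proof. by case: hn => -[]. Qed.
Let ab : dotr n1 n2 = 0. Proof. by case: hn => _ []. Qed.
Let ba : dotr n2 n1 = 0. Proof. by rewrite -ab !dotrE; ring. Qed.
Local Notation x := (\tr (rho *m Jd n1)).
Local Notation y := (\tr (rho *m Jd n2)).

(** The basis may be left-handed, so [n3] is [cross n1 n2] only up to sign; the absolute value
    removes the sign. *)
Lemma norm_mean_third :
  `|\tr (rho *m Jd n3)| = `|\tr (rho *m Jd (cross n1 n2))|.
Proof.
have [[_ _ cc] [_ ac bc]] := hn.
have d1 : dotr n3 n1 = 0 by rewrite -ac !dotrE; ring.
have d2 : dotr n3 n2 = 0 by rewrite -bc !dotrE; ring.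
have n3E := frame_expansion aa bb ab n3.
rewrite d1 d2 !scale0r !add0r in n3E.
set k := dotr _ _ in n3E.
have k1 : k ^+ 2 = 1.
  have : dotr (k *: cross n1 n2) (k *: cross n1 n2) = 1 by rewrite -n3E.
  have -> : dotr (k *: cross n1 n2) (k *: cross n1 n2) =
      k ^+ 2 * dotr (cross n1 n2) (cross n1 n2) by rewrite !dotrE !mxZE; ring.
  by rewrite dotr_cross_cross aa bb ab expr0n subr0 !mulr1.
rewrite n3E; move/eqP: k1; rewrite sqrf_eq1 => /orP[] /eqP ->.
  by rewrite scale1r.
by rewrite scaleN1r JdirN mulmxN raddfN normrN.
Qed.

Lemma geometric_form_of_condition (s t : R) : equality_equations rho n1 n2 s t ->
  s = - t -> x = 0 -> y = 0 -> geometric_form rho.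
Proof.
move=> eqs st x0 y0; case: (leP 0 s) => s0.
  exact: (geometric_of_condition aa bb ab eqs st x0 y0 s0).
apply: (geometric_of_condition bb aa ba (equality_equations_sym eqs) _ y0 x0).
  by rewrite st opprK.
by rewrite -oppr_le0 -st ltW.
Qed.

Lemma reciprocal_cases (s t : R) : s * t = -1 ->
  (-1 < s <= 1) \/ ((-1 < t <= 1) /\ (1 < `|s| \/ t = 1)).
Proof.
move=> st; case: (ltrP 1 `|s|) => s1.
  right; split; last by left.
  have t1 : `|t| < 1.
    have : `|s| * `|t| = 1 by rewrite -normrM st normrN1.
    by move=> E; have := normr_ge0 t; nra.
  by move: t1; rewrite ltr_norml => /andP[-> /ltW ->].
move: s1; rewrite ler_norml => /andP[s1 s2].
have [sE|sN] := eqVneq s (-1); last by left; rewrite s2 lt_neqAle eq_sym sN s1.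
right; have -> : t = 1 by move: st; rewrite sE mulN1r => /oppr_inj.
by split; [rewrite lexx andbT; lra | right].
Qed.

(** For [|s| < 1] it is the mean along [n1] that vanishes, for [|s| > 1] the one along [n2], and for
    [|s| = 1] both do. This is why [cond2'] stands beside [cond2]. *)
Lemma squeezed_conditions (s t : R) : equality_equations rho n1 n2 s t -> s * t = -1 ->
  [/\ squeezed_form rho, x = 0 \/ y = 0 & 1 <= `|s| -> y = 0].
Proof.
move=> eqs st; have [s1|[t1 s1]] := reciprocal_cases st.
  have [sq x0 y0] := squeezed_of_equality_equations rho_density aa bb ab st s1 eqs.
  split; [exact: sq | by left | move=> s2; apply: y0; apply/eqP].
  move: s1 => /andP[s1 s1']; rewrite eq_le s1' /=.
  by rewrite leNgt; apply/negP => s3; move: s2; rewrite leNgt ltr_norml s1 s3.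
have ts : t * s = -1 by rewrite mulrC.
have [sq y0 x0] := squeezed_of_equality_equations rho_density bb aa ba ts t1
  (equality_equations_sym eqs).
by split; [exact: sq | right | move=> _].
Qed.

End Cases.

Theorem mainTheorem1 (R : realType) (d : nat) (hd : (0 < d)%N)
    (n1 n2 n3 : 'rV[R]_3) (hn : orthonormal_basis3 n1 n2 n3)
    (rho : 'M[R[i]]_d.+1) (hrho : density rho) :
  let u := 4 * \tr (rho *m Jdir n2) in
  let v := 4 * \tr (rho *m Jdir n1) in
  let cond1 (s t : R) := [/\ s = - t, u = 0 & v = 0] in
  let cond2 (s t : R) := s * t = -1 /\ u = 0 in
  let cond2' (s t : R) := s * t = -1 /\ v = 0 in
  [/\ minimum_uncertainty rho n1 n2 n3 ->
        rotated_diagonal rho \/ rotated_pure rho,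
      minimum_uncertainty rho n1 n2 n3 -> \tr (rho *m Jdir n3) <> 0 ->
        geometric_form rho \/ squeezed_form rho,
      minimum_uncertainty rho n1 n2 n3 /\ \tr (rho *m Jdir n3) <> 0 <->
        exists s t : R, equality_equations rho n1 n2 s t &
      forall s t : R, equality_equations rho n1 n2 s t ->
        [/\ cond1 s t \/ cond2 s t \/ cond2' s t,
            1 <= `|s| -> cond1 s t \/ cond2 s t,
            cond1 s t -> geometric_form rho &
            cond2 s t \/ cond2' s t -> squeezed_form rho]].
Proof.
move=> u v cond1 cond2 cond2'.
have [[aa bb _] [ab _ _]] := hn.
have four (z : R[i]) : 4 * z = 0 <-> z = 0.
  by split=> [/eqP|->]; rewrite ?mulr0 // mulf_eq0 pnatr_eq0 => /eqP.
have u0 := four (\tr (rho *m Jdir n2)); have v0 := four (\tr (rho *m Jdir n1)).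
rewrite -/u in u0; rewrite -/v in v0.
have iffE := minimum_uncertainty_equations hd hrho aa bb ab (norm_mean_third rho hn).
have cases s t : equality_equations rho n1 n2 s t ->
    [/\ cond1 s t \/ cond2 s t \/ cond2' s t, 1 <= `|s| -> cond1 s t \/ cond2 s t,
        cond1 s t -> geometric_form rho & cond2 s t \/ cond2' s t -> squeezed_form rho].
  move=> eqs; have dich := equality_parameters hd hrho aa bb ab eqs.
  have geo : cond1 s t -> geometric_form rho.
    by move=> [st y0 x0]; exact: (geometric_form_of_condition hrho hn eqs st (v0.1 x0) (u0.1 y0)).
  have sqz : s * t = -1 -> squeezed_form rho.
    by move=> st; have [sq _ _] := squeezed_conditions hrho hn eqs st.
  split; [| | exact: geo | by case=> -[/sqz]].
    case: dich => [st|[st x0 y0]]; last by left; split; [exact: st | exact: (u0.2 y0) | exact: (v0.2 x0)].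
    have [_ [x0|y0] _] := squeezed_conditions hrho hn eqs st.
      by right; right; split; [exact: st | exact: (v0.2 x0)].
    by right; left; split; [exact: st | exact: (u0.2 y0)].
  move=> s1; case: dich => [st|[st x0 y0]].
    have [_ _ y0] := squeezed_conditions hrho hn eqs st.
    by right; split; [exact: st | exact: (u0.2 (y0 s1))].
  by left; split; [exact: st | exact: (u0.2 y0) | exact: (v0.2 x0)].
have forms : minimum_uncertainty rho n1 n2 n3 -> \tr (rho *m Jdir n3) <> 0 ->
    geometric_form rho \/ squeezed_form rho.
  move=> mu tau; have [s [t eqs]] := iffE.1 (conj mu tau).
  have [c _ geo sqz] := cases s t eqs.
  by case: c => [/geo|/sqz]; [left | right].
split; [| exact: forms | exact: iffE | exact: cases].
(* If the mean along [n3] is zero, equality says that one of the two uncertainties vanishes. The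
   state then commutes with that spin component and is a rotated diagonal state, with no constraint
   on its weights. *)
move=> mu; case: (eqVneq (\tr (rho *m Jdir n3)) 0) => [tau0|/eqP tau].
  left; move: mu; rewrite /minimum_uncertainty tau0 normr0 expr0n mulr0 => /eqP.
  rewrite mulf_eq0 => /orP[] /eqP.
    exact: (rotated_diagonal_of_uncertainty hrho aa bb ab).
  have ba : dotr n2 n1 = 0 by rewrite -ab !dotrE; ring.
  exact: (rotated_diagonal_of_uncertainty hrho bb aa ba).
have [/rotated_diagonal_of_geometric|/rotated_pure_of_squeezed] := forms mu tau.
  by left.
by right.
Qed.
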